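(* Let $k>0$, $\gamma>1$, $P(\rho)=k^2\rho^\gamma$. Let initial data $(\rho_0,u_0)$ on $\mathbb{R}$ be such that the initial values $\tilde w_0,\tilde z_0$ of the Riemann variables satisfy $\inf_{\mathbb{R}}(\tilde w_0-\tilde z_0)>0$, $(\tilde w_0,\tilde z_0)\in C^1(\mathbb{R})$ and $\|(\tilde w_0,\tilde z_0)\|_{C^1(\mathbb{R})}<\infty$. For the $C^1$ solution of the $1$-dimensional isentropic compressible Euler equations $\rho_t+(\rho u)_x=0$, $(\rho u)_t+(\rho u^2)_x+P_x=0$ with these data, let $y^i(t,y^i_0)$ $(i=1,2)$ be the two characteristic curves starting from $(0,y^i_0)$. Then $$\big(e^{-\tilde h}\tilde\lambda_{1\tilde z}\big)(t,y^1(t,y^1_0))\ge\frac{1}{C_1+C_2t},\qquad \big(e^{-\tilde h}\tilde\lambda_{2\tilde w}\big)(t,y^2(t,y^2_0))\ge\frac1{C_1+C_2t}$$ for as long as the $C^1$ solution exists, for positive constants $C_1,C_2$ independent of the time.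
   Context: A $C^1$ solution on $(0,T)\times\mathbb{R}$ is a pair with $\rho>0$, $\rho,u\in C^1([0,T)\times\mathbb{R})$, satisfying the equations pointwise and attaining the data continuously. Riemann variables: $\tilde w=u+\int_0^\rho\frac{\sqrt{P'(\sigma)}}{\sigma}d\sigma$, $\tilde z=u-\int_0^\rho\frac{\sqrt{P'(\sigma)}}{\sigma}d\sigma$. Eigenvalues: $\tilde\lambda_1=u-\sqrt{P'(\rho)}$, $\tilde\lambda_2=u+\sqrt{P'(\rho)}$; as functions of $(\tilde w,\tilde z)$, $\tilde\lambda_1=\frac{\tilde w+\tilde z}{2}-\frac{(\gamma-1)(\tilde w-\tilde z)}{4}$, $\tilde\lambda_2=\frac{\tilde w+\tilde z}{2}+\frac{(\gamma-1)(\tilde w-\tilde z)}{4}$, and $\tilde\lambda_{1\tilde z}=\partial\tilde\lambda_1/\partial\tilde z$, $\tilde\lambda_{2\tilde w}=\partial\tilde\lambda_2/\partial\tilde w$. The characteristics solve $\frac{dy^i}{dt}=\tilde\lambda_i$, $y^i(0,y_0^i)=y^i_0$. The function $\tilde h$ is $\tilde h=\frac{\gamma-3}{2\gamma-2}\ln(\tilde w-\tilde z)$. ''Independent of the time'' means that $C_1,C_2$ do not depend on $t$ or on the existence time of the solution. *)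

(* Defs.v *)
From Stdlib Require Import Reals.
From Coquelicot Require Import Coquelicot.
Open Scope R_scope.

(** ** Pressure law, sound speed, Riemann variables *)

(* [Rpower] has junk values at nonpositive bases; [pressure] is only meaningful
   for [r > 0], which is the only range that matters below. *)
Definition pressure (k gamma r : R) : R := k ^ 2 * Rpower r gamma.

Definition sound_speed (k gamma r : R) : R := sqrt (Derive (pressure k gamma) r).

(* The integral from 0 to r of sqrt(P'(s))/s; it is improper at 0 when
   [gamma < 3]. *)
Definition riemann_integral (k gamma r : R) : R :=
  RInt_gen (fun s => sound_speed k gamma s / s) (at_right 0) (at_point r).

Definition riemann_w (k gamma rho u : R) : R := u + riemann_integral k gamma rho.
Definition riemann_z (k gamma rho u : R) : R := u - riemann_integral k gamma rho.

(** ** Eigenvalues *)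

Definition lambda1 (k gamma rho u : R) : R := u - sound_speed k gamma rho.
Definition lambda2 (k gamma rho u : R) : R := u + sound_speed k gamma rho.

(* The same eigenvalues as functions of the Riemann variables (w, z). *)
Definition lambda1_wz (gamma w z : R) : R :=
  (w + z) / 2 - (gamma - 1) * (w - z) / 4.
Definition lambda2_wz (gamma w z : R) : R :=
  (w + z) / 2 + (gamma - 1) * (w - z) / 4.

Definition lambda1_z (gamma w z : R) : R := Derive (fun z' => lambda1_wz gamma w z') z.
Definition lambda2_w (gamma w z : R) : R := Derive (fun w' => lambda2_wz gamma w' z) w.

Definition h_tilde (gamma w z : R) : R :=
  (gamma - 3) / (2 * gamma - 2) * ln (w - z).

(** ** Regularity and norms of functions of one variable *)

Definition C1_R (f : R -> R) : Prop :=
  forall x, ex_derive f x /\ continuous (Derive f) x.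

Definition inf_R (f : R -> R) : Rbar := Glb_Rbar (fun r => exists x, r = f x).
Definition sup_norm (f : R -> R) : Rbar := Lub_Rbar (fun r => exists x, r = Rabs (f x)).

(* All the summands are suprema of nonnegative quantities, so [Rbar_plus] never
   meets the undefined case (+oo) + (-oo). *)
Definition C1_norm (f : R -> R) : Rbar := Rbar_plus (sup_norm f) (sup_norm (Derive f)).
Definition C1_norm_pair (f g : R -> R) : Rbar := Rbar_plus (C1_norm f) (C1_norm g).

(** ** C^1 solutions of the isentropic Euler equations *)

Definition strip (T : R) (p : R * R) : Prop := 0 <= fst p < T.

(* f belongs to C^1([0,T) x R), time being the first variable: f is continuous
   on [0,T) x R and its partial derivatives, which exist in (0,T) x R, extend
   continuously up to t = 0. *)
Definition C1_strip (T : R) (f : R -> R -> R) : Prop :=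
  continuous_on (strip T) (fun p : R * R => f (fst p) (snd p)) /\
  exists ft fx : R -> R -> R,
    continuous_on (strip T) (fun p : R * R => ft (fst p) (snd p)) /\
    continuous_on (strip T) (fun p : R * R => fx (fst p) (snd p)) /\
    forall t x, 0 < t < T ->
      is_derive (fun s => f s x) t (ft t x) /\
      is_derive (fun y => f t y) x (fx t x).

Record C1_Euler_solution (k gamma : R) (rho0 u0 : R -> R)
    (T : R) (rho u : R -> R -> R) : Prop := {
  sol_time : 0 < T;
  sol_rho_pos : forall t x, 0 <= t < T -> 0 < rho t x;
  sol_rho_C1 : C1_strip T rho;
  sol_u_C1 : C1_strip T u;
  sol_mass : forall t x, 0 < t < T ->
    Derive (fun s => rho s x) t + Derive (fun y => rho t y * u t y) x = 0;
  sol_momentum : forall t x, 0 < t < T ->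
    Derive (fun s => rho s x * u s x) t
    + Derive (fun y => rho t y * u t y ^ 2) x
    + Derive (fun y => pressure k gamma (rho t y)) x = 0;
  (* continuity up to t = 0 is part of [C1_strip] *)
  sol_rho_init : forall x, rho 0 x = rho0 x;
  sol_u_init : forall x, u 0 x = u0 x
}.

(* On [0,T), y solves dy/dt = lam(t, y), y(0) = y0. The equation is imposed for
   0 < t < T together with right continuity at 0; when lam is continuous this
   forces the one-sided derivative at 0 as well. *)
Definition characteristic (T : R) (lam : R -> R -> R) (y0 : R) (y : R -> R) : Prop :=
  y 0 = y0 /\
  filterlim y (at_right 0) (locally y0) /\
  forall t, 0 < t < T -> is_derive y t (lam t (y t)).

(* Main.v *)
(* Write e^h = (w - z)^theta with theta = (gamma - 3) / (2 gamma - 2). Since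
   lambda1_z = lambda2_w = (gamma + 1) / 4, the claim is that e^h grows at most
   linearly along characteristics. Along a 1-characteristic z is constant and
   (e^h)' = beta e^h w_x with beta = (3 - gamma) / 4. If beta <= 0, then theta >= 0
   and the maximum principle for w and z suffices. If beta > 0, one needs
   e^h w_x <= C, which follows from Lax's Riccati equation
   (e^h w_x)' = - kappa e^h w_x^2 along 2-characteristics. The second family is
   obtained by the reflection (w, z)(t, x) -> (- z, - w)(t, - x).

   No global bound on the solution is assumed and no characteristic has to be
   constructed: both the maximum principle and the Riccati bound are obtained by a
   first-failure-time argument on backward cones, the slope of the cone being a
   bound for the speeds at the points where the barrier is touched. *)

Require Import Defs.
From Stdlib Require Import Reals Lra Psatz Classical.
From Coquelicot Require Import Coquelicot.
Open Scope R_scope.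

(** * Continuous functions on a strip *)

Definition cont_strip (T : R) (f : R -> R -> R) : Prop :=
  continuous_on (strip T) (fun p : R * R => f (fst p) (snd p)).

(** Balls of the product are squares, so the relative filter statement splits into separate bounds
    in time and in space; at [t = 0] it is one-sided in time. *)
Lemma cont_stripP (T : R) (f : R -> R -> R) :
  cont_strip T f <->
  forall t x, 0 <= t < T -> forall eps : posreal, exists delta : posreal,
    forall t' x', 0 <= t' < T -> Rabs (t' - t) < delta -> Rabs (x' - x) < delta ->
      Rabs (f t' x' - f t x) < eps.
Proof.
  split.
  - intros Hf t x Ht eps.
    destruct (Hf (t, x) Ht (ball (f t x) eps) (locally_ball _ eps)) as [d Hd].
    exists d. intros t' x' Ht' H1 H2.
    exact (Hd (t', x') (conj H1 H2) Ht').
  - intros Hf [t x] Ht P [eps HP].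
    destruct (Hf t x Ht eps) as [d Hd].
    exists d. intros [t' x'] [H1 H2] Ht'.
    apply HP. exact (Hd t' x' Ht' H1 H2).
Qed.

Lemma cont_strip_const (T c : R) : cont_strip T (fun _ _ => c).
Proof. intros p _. apply filterlim_const. Qed.

Lemma cont_strip_time (T : R) (g : R -> R) :
  (forall t, continuous g t) -> cont_strip T (fun t _ => g t).
Proof.
  intros Hg. apply cont_stripP. intros t x _ eps.
  destruct (Hg t (ball (g t) eps) (locally_ball _ eps)) as [d Hd].
  exists d. intros t' x' _ H1 _. exact (Hd t' H1).
Qed.

Lemma cont_strip_plus (T : R) (f g : R -> R -> R) :
  cont_strip T f -> cont_strip T g -> cont_strip T (fun t x => f t x + g t x).
Proof.
  intros Hf Hg p Hp.
  exact (filterlim_comp_2 _ _ _ (Hf p Hp) (Hg p Hp)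
    (filterlim_plus (V := R_NormedModule) _ _)).
Qed.

Lemma cont_strip_mult (T : R) (f g : R -> R -> R) :
  cont_strip T f -> cont_strip T g -> cont_strip T (fun t x => f t x * g t x).
Proof.
  intros Hf Hg p Hp.
  exact (filterlim_comp_2 _ _ _ (Hf p Hp) (Hg p Hp)
    (filterlim_mult (K := R_AbsRing) _ _)).
Qed.

Lemma cont_strip_comp (T : R) (phi : R -> R) (f : R -> R -> R) :
  (forall t x, 0 <= t < T -> continuous phi (f t x)) ->
  cont_strip T f -> cont_strip T (fun t x => phi (f t x)).
Proof.
  intros Hphi Hf p Hp.
  exact (filterlim_comp _ _ _ _ _ _ _ _ (Hf p Hp) (Hphi (fst p) (snd p) Hp)).
Qed.

Lemma cont_strip_scal (T c : R) (f : R -> R -> R) :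
  cont_strip T f -> cont_strip T (fun t x => c * f t x).
Proof. intros Hf. apply cont_strip_mult; [apply cont_strip_const | exact Hf]. Qed.

Lemma cont_strip_minus (T : R) (f g : R -> R -> R) :
  cont_strip T f -> cont_strip T g -> cont_strip T (fun t x => f t x - g t x).
Proof.
  intros Hf Hg.
  apply (continuous_on_ext _ (fun p => f (fst p) (snd p) + -1 * g (fst p) (snd p))).
  - intros p _. simpl. ring.
  - apply (cont_strip_plus T f (fun t x => -1 * g t x)); [exact Hf | apply cont_strip_scal; exact Hg].
Qed.

Lemma cont_strip_shift (T eta : R) (f : R -> R -> R) :
  cont_strip T f -> cont_strip T (fun t x => f t (x + eta)).
Proof.
  rewrite !cont_stripP. intros Hf t x Ht eps.
  destruct (Hf t (x + eta) Ht eps) as [d Hd].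
  exists d. intros t' x' Ht' H1 H2. apply Hd; trivial.
  now replace (x' + eta - (x + eta)) with (x' - x) by ring.
Qed.

Lemma cont_strip_reflect (T : R) (f : R -> R -> R) :
  cont_strip T f -> cont_strip T (fun t x => f t (- x)).
Proof.
  rewrite !cont_stripP. intros Hf t x Ht eps.
  destruct (Hf t (- x) Ht eps) as [d Hd].
  exists d. intros t' x' Ht' H1 H2. apply Hd; trivial.
  replace (- x' - - x) with (- (x' - x)) by ring. now rewrite Rabs_Ropp.
Qed.

Lemma cont_strip_max (T : R) (f g : R -> R -> R) :
  cont_strip T f -> cont_strip T g -> cont_strip T (fun t x => Rmax (f t x) (g t x)).
Proof.
  intros Hf Hg.
  apply (continuous_on_ext _ (fun p => / 2 * (f (fst p) (snd p) + g (fst p) (snd p)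
           + Rabs (f (fst p) (snd p) - g (fst p) (snd p))))).
  - intros [t x] _. cbn [fst snd]. unfold Rmax, Rabs. destruct Rle_dec, Rcase_abs; lra.
  - apply (cont_strip_scal T (/ 2)
      (fun t x => f t x + g t x + Rabs (f t x - g t x))).
    apply cont_strip_plus; [now apply cont_strip_plus |].
    apply cont_strip_comp.
    + intros. apply continuous_Rabs.
    + now apply cont_strip_minus.
Qed.

Lemma cont_strip_interior (T : R) (f : R -> R -> R) (t x : R) :
  cont_strip T f -> 0 < t < T ->
  continuous (fun p : R * R => f (fst p) (snd p)) (t, x).
Proof.
  intros Hf Ht.
  apply (continuous_continuous_on (strip T)); [| exact Hf].
  assert (Hd : 0 < Rmin t (T - t)) by (apply Rmin_glb_lt; lra).
  exists (mkposreal _ Hd). intros [t' x'] [H1 _].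
  change (Rabs (t' - t) < Rmin t (T - t)) in H1. unfold strip; simpl.
  pose proof (Rmin_l t (T - t)). pose proof (Rmin_r t (T - t)).
  apply Rabs_def2 in H1. lra.
Qed.

(* Freezing [f] at its initial values for negative times turns continuity
   relative to the strip into two-sided continuity. *)
Lemma cont_strip_extend (T : R) (f : R -> R -> R) (t x : R) :
  cont_strip T f -> 0 <= t < T ->
  continuity_2d_pt (fun s y => f (Rmax 0 s) y) t x.
Proof.
  intros Hf Ht eps.
  destruct (proj1 (cont_stripP T f) Hf t x Ht eps) as [d Hd].
  assert (Hd' : 0 < Rmin d (T - t)) by (apply Rmin_glb_lt; [apply cond_pos | lra]).
  pose proof (Rmin_l d (T - t)). pose proof (Rmin_r d (T - t)).
  exists (mkposreal _ Hd'). simpl. intros s y H1 H2.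
  rewrite (Rmax_right 0 t) by lra.
  apply Rabs_def2 in H1.
  apply Hd.
  - unfold Rmax; destruct Rle_dec; lra.
  - unfold Rmax; destruct Rle_dec; apply Rabs_def1; lra.
  - lra.
Qed.

(** * Compactness on rectangles in the strip, and the cone barrier *)

Lemma cont_strip_unif (T : R) (f : R -> R -> R) (t1 a b : R) (eps : posreal) :
  cont_strip T f -> t1 < T ->
  exists delta : posreal, forall t x t' x',
    0 <= t <= t1 -> a <= x <= b -> 0 <= t' <= t1 -> a <= x' <= b ->
    Rabs (t' - t) < delta -> Rabs (x' - x) < delta ->
    Rabs (f t' x' - f t x) < eps.
Proof.
  intros Hf Ht1.
  destruct (uniform_continuity_2d (fun s y => f (Rmax 0 s) y) 0 t1 a b) with (eps := eps)
    as [d Hd].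
  - intros t x Ht Hx. apply (cont_strip_extend T); [exact Hf | lra].
  - exists d. intros t x t' x' Ht Hx Ht' Hx' H1 H2.
    specialize (Hd t x t' x' Ht Hx Ht' Hx' H1 H2).
    now rewrite !Rmax_right in Hd by lra.
Qed.

Lemma cont_strip_bounded (T : R) (f : R -> R -> R) (t1 a b : R) :
  cont_strip T f -> t1 < T ->
  exists B : posreal, forall t x, 0 <= t <= t1 -> a <= x <= b -> Rabs (f t x) <= B.
Proof.
  intros Hf Ht1.
  destruct (Rlt_le_dec t1 0) as [H0 | H0].
  { exists (mkposreal 1 Rlt_0_1). intros. lra. }
  destruct (Rlt_le_dec b a) as [Hab | Hab].
  { exists (mkposreal 1 Rlt_0_1). intros. lra. }
  destruct (cont_strip_unif T f t1 a b (mkposreal 1 Rlt_0_1) Hf Ht1) as [d Hd].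
  simpl in Hd.
  assert (Hdp := cond_pos d).
  set (c := Rabs (f 0 a)).
  (* walking from the corner (0, a) in steps shorter than [delta] *)
  assert (Hn : forall n t x, 0 <= t <= t1 -> a <= x <= b ->
    t <= INR n * (d / 2) -> x - a <= INR n * (d / 2) -> Rabs (f t x) <= c + INR n).
  { induction n as [| n IH]; intros t x Ht Hx H1 H2.
    - simpl in *. replace t with 0 by lra. replace x with a by lra. fold c. lra.
    - rewrite S_INR in *.
      set (t' := Rmax 0 (t - d / 2)). set (x' := Rmax a (x - d / 2)).
      assert (Ht' : 0 <= t' <= t /\ t - d / 2 <= t' /\ t' <= INR n * (d / 2)).
      { assert (0 <= INR n * (d / 2)) by (apply Rmult_le_pos; [apply pos_INR | lra]).
        unfold t', Rmax; destruct Rle_dec; lra. }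
      assert (Hx' : a <= x' <= x /\ x - d / 2 <= x' /\ x' - a <= INR n * (d / 2)).
      { assert (0 <= INR n * (d / 2)) by (apply Rmult_le_pos; [apply pos_INR | lra]).
        unfold x', Rmax; destruct Rle_dec; lra. }
      assert (IH' : Rabs (f t' x') <= c + INR n) by (apply IH; lra).
      assert (Hs : Rabs (f t x - f t' x') < 1).
      { apply Hd; try lra; apply Rabs_def1; lra. }
      pose proof (Rabs_triang (f t x - f t' x') (f t' x')) as Htr.
      replace (f t x - f t' x' + f t' x') with (f t x) in Htr by ring. lra. }
  (* Enough steps of length [d / 2] to cover the time length and the space length added together,
     hence each of them. *)
  destruct (nfloor_ex ((t1 + (b - a)) / (d / 2))) as [n Hn'].
  { apply Rmult_le_pos; [lra | left; apply Rinv_0_lt_compat; lra]. }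
  assert (Hbig : t1 + (b - a) <= INR (S n) * (d / 2)).
  { rewrite S_INR. apply Rmult_le_reg_r with (/ (d / 2)).
    - apply Rinv_0_lt_compat; lra.
    - rewrite Rmult_assoc, Rinv_r by lra. unfold Rdiv in Hn' at 1. lra. }
  assert (HB : 0 < c + INR (S n) + 1).
  { pose proof (Rabs_pos (f 0 a)). pose proof (pos_INR (S n)). unfold c. lra. }
  exists (mkposreal _ HB). intros t x Ht Hx. cbn [pos].
  apply Rle_trans with (c + INR (S n)); [apply Hn; lra | lra].
Qed.

(* On the backward cone with apex [(t1, x1)] and slope [M]: at the first time at
   which [G] vanishes, going back in time with an admissible speed stays inside
   the cone, where [G] was still negative. *)
Lemma cone_barrier (T : R) (G : R -> R -> R) (t1 x1 M : R) :
  cont_strip T G -> 0 <= t1 < T -> 0 <= M ->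
  (forall x, Rabs (x - x1) <= M * t1 -> G 0 x < 0) ->
  (forall t x, 0 < t <= t1 -> Rabs (x - x1) <= M * (t1 - t) -> G t x = 0 ->
     exists v, Rabs v <= M /\
       forall delta, 0 < delta -> exists s, 0 < s < delta /\ 0 <= G (t - s) (x - v * s)) ->
  G t1 x1 < 0.
Proof.
  intros HG Ht1 HM H0 Hback.
  (* [tau] will be the supremum of the times up to which [G < 0] on the cone. It is shown to be such
     a time itself, and then to equal [t1]. *)
  set (good := fun t => 0 <= t <= t1 /\ forall s x, 0 <= s <= t ->
    Rabs (x - x1) <= M * (t1 - s) -> G s x < 0).
  assert (Hgood0 : good 0).
  { split; [lra |]. intros s x Hs Hx. replace s with 0 in * by lra.
    apply H0. now rewrite Rminus_0_r in Hx. }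
  destruct (completeness good) as [tau [Hub Hlub]].
  { exists t1. intros t [Ht _]. lra. }
  { now exists 0. }
  assert (Htau : 0 <= tau <= t1).
  { split; [now apply Hub | apply Hlub; intros t [Ht _]; lra]. }
  assert (Hbefore : forall s x, 0 <= s < tau ->
    Rabs (x - x1) <= M * (t1 - s) -> G s x < 0).
  { intros s x Hs Hx. apply NNPP. intros Hn.
    assert (Hs' : tau <= s); [| lra].
    apply Hlub. intros t [Ht Hgt].
    destruct (Rle_lt_dec t s) as [H | H]; [exact H |].
    exfalso. apply Hn, (Hgt s x); [lra | exact Hx]. }
  assert (Hcone : forall t x v s, Rabs (x - x1) <= M * (t1 - t) -> Rabs v <= M -> 0 <= s ->
    Rabs (x - v * s - x1) <= M * (t1 - (t - s))).
  { intros t x v s Hx Hv Hs.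
    replace (x - v * s - x1) with ((x - x1) + - (v * s)) by ring.
    eapply Rle_trans; [apply Rabs_triang |].
    rewrite Rabs_Ropp, Rabs_mult, (Rabs_pos_eq s Hs).
    apply Rmult_le_compat_r with (r := s) in Hv; lra. }
  (* Continuity along the vertical segment, which stays in the cone, gives [G <= 0] at a positive
     [tau]. A zero there is excluded by [Hback], whose backward point lies in the cone at an earlier
     time. *)
  assert (Hat : forall x, Rabs (x - x1) <= M * (t1 - tau) -> G tau x < 0).
  { destruct (Req_dec tau 0) as [E | E].
    { intros x Hx. apply (proj2 Hgood0); [lra |].
      now rewrite E in Hx |- *. }
    intros x Hx.
    assert (Hle : G tau x <= 0).
    { destruct (Rle_lt_dec (G tau x) 0) as [H | H]; [exact H |].
      destruct (proj1 (cont_stripP T G) HG tau x ltac:(lra) (mkposreal _ H)) as [d Hd].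
      simpl in Hd. assert (Hdp := cond_pos d).
      set (s := Rmin (d / 2) tau).
      assert (Hs : 0 < s <= d / 2 /\ s <= tau).
      { split; [split |]; [apply Rmin_glb_lt; lra | apply Rmin_l | apply Rmin_r]. }
      assert (Hlt : G (tau - s) x < 0).
      { apply Hbefore; [lra |].
        replace x with (x - 0 * s) by ring.
        apply Hcone; [exact Hx | rewrite Rabs_R0; exact HM | lra]. }
      assert (Hc : Rabs (G (tau - s) x - G tau x) < G tau x).
      { apply Hd; [lra | apply Rabs_def1; lra |].
        rewrite Rminus_diag, Rabs_R0. exact Hdp. }
      apply Rabs_def2 in Hc. lra. }
    destruct Hle as [Hlt | Heq]; [exact Hlt | exfalso].
    destruct (Hback tau x ltac:(lra) Hx Heq) as [v [Hv Hs]].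
    destruct (Hs tau ltac:(lra)) as [s [Hs1 Hs2]].
    assert (G (tau - s) (x - v * s) < 0); [| lra].
    apply Hbefore; [lra | apply Hcone; lra]. }
  assert (Hgoodtau : good tau).
  { split; [exact Htau |]. intros s x Hs Hx.
    destruct (Rle_lt_or_eq_dec s tau) as [H | H]; [lra | apply Hbefore; [lra | exact Hx] |].
    subst s. now apply Hat. }
  (* If [tau < t1], the maximum of [G] over the compact slice at [tau] is negative, and uniform
     continuity keeps [G] negative slightly beyond [tau], since later slices are contained in this
     one. This contradicts the choice of [tau]. *)
  destruct (Rle_lt_or_eq_dec tau t1) as [Hlt | Heq]; [lra | exfalso |].
  2: { apply (proj2 Hgoodtau); [lra |].
       rewrite !Rminus_diag, Rabs_R0. lra. }
  set (L := M * (t1 - tau)).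
  assert (HL : 0 <= L) by (apply Rmult_le_pos; lra).
  assert (Hslice : forall x, x1 - L <= x <= x1 + L -> Rabs (x - x1) <= L).
  { intros x Hx. apply Rabs_le. lra. }
  destruct (continuity_ab_maj (fun x => G tau x) (x1 - L) (x1 + L)) as [xm [Hmax Hxm]].
  { lra. }
  { intros x Hx. apply continuity_pt_filterlim. intros P [eps HP].
    destruct (proj1 (cont_stripP T G) HG tau x ltac:(lra) eps) as [d Hd].
    exists d. intros y Hy. apply HP. apply Hd; [lra | | exact Hy].
    rewrite Rminus_diag, Rabs_R0. apply cond_pos. }
  assert (Hm : G tau xm < 0) by (apply Hat, Hslice, Hxm).
  assert (Hm' : 0 < - G tau xm) by lra.
  destruct (cont_strip_unif T G t1 (x1 - L) (x1 + L) (mkposreal _ Hm') HG ltac:(lra))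
    as [d Hd].
  simpl in Hd. assert (Hdp := cond_pos d).
  set (s0 := Rmin (tau + d / 2) t1).
  assert (Hs0 : tau < s0 <= tau + d / 2 /\ s0 <= t1).
  { split; [split |]; [apply Rmin_glb_lt; lra | apply Rmin_l | apply Rmin_r]. }
  assert (Hgs : good s0).
  { split; [lra |]. intros s x Hs Hx.
    destruct (Rle_lt_dec s tau) as [H | H].
    { apply (proj2 Hgoodtau); [lra | exact Hx]. }
    assert (HxL : Rabs (x - x1) <= L).
    { eapply Rle_trans; [exact Hx |]. apply Rmult_le_compat_l; lra. }
    assert (HxL' : x1 - L <= x <= x1 + L) by (apply Rabs_le_between in HxL; lra).
    assert (Hc : Rabs (G s x - G tau x) < - G tau xm).
    { apply Hd; try lra; [apply Rabs_def1; lra |].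
      rewrite Rminus_diag, Rabs_R0. exact Hdp. }
    apply Rabs_def2 in Hc. specialize (Hmax x HxL'). simpl in Hmax. lra. }
  specialize (Hub s0 Hgs). lra.
Qed.

(** * The Riemann system *)

(** The derivatives are made arguments so that equations can mention them down to [t = 0], where
    they are continuous extensions. *)
Definition C1_strip_with (T : R) (f ft fx : R -> R -> R) : Prop :=
  cont_strip T f /\ cont_strip T ft /\ cont_strip T fx /\
  forall t x, 0 < t < T ->
    is_derive (fun s => f s x) t (ft t x) /\ is_derive (fun y => f t y) x (fx t x).

(** Joint differentiability comes from the time derivative existing near the point and being
    continuous there, together with the space derivative at the point; the chain rule then
    applies. *)
Lemma is_derive_along (T : R) (f ft fx : R -> R -> R) (y : R -> R) (t l : R) :
  C1_strip_with T f ft fx -> 0 < t < T -> is_derive y t l ->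
  is_derive (fun s => f s (y s)) t (ft t (y t) + l * fx t (y t)).
Proof.
  intros (Hf & Hft & Hfx & Hd) Ht Hy.
  apply is_derive_Reals.
  replace (ft t (y t) + l * fx t (y t)) with (ft t (y t) * 1 + fx t (y t) * l) by ring.
  apply (derivable_pt_lim_comp_2d f (fun s => s) y).
  - apply filterdiff_differentiable_pt_lim.
    apply (is_derive_filterdiff f t (y t) ft (fx t (y t))).
    + assert (Hp : 0 < Rmin t (T - t)) by (apply Rmin_glb_lt; lra).
      exists (mkposreal _ Hp). intros [t' x'] [H1 _].
      change (Rabs (t' - t) < Rmin t (T - t)) in H1.
      pose proof (Rmin_l t (T - t)). pose proof (Rmin_r t (T - t)).
      apply Rabs_def2 in H1. apply Hd. simpl. lra.
    + now apply Hd.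
    + now apply (cont_strip_interior T).
  - apply derivable_pt_lim_id.
  - now apply is_derive_Reals.
Qed.

(** A function with negative derivative was larger just before. This produces the backward points
    that [cone_barrier] asks for. *)
Lemma is_derive_neg_before (g : R -> R) (t l : R) :
  is_derive g t l -> l < 0 -> 0 <= g t ->
  forall delta, 0 < delta -> exists s, 0 < s < delta /\ 0 <= g (t - s).
Proof.
  intros Hg Hl H0 delta Hdelta.
  apply is_derive_Reals in Hg.
  destruct (Hg (- l) ltac:(lra)) as [d Hd].
  assert (Hdp := cond_pos d).
  set (s := Rmin delta d / 2).
  assert (Hs : 0 < s < delta /\ s < d).
  { pose proof (Rmin_l delta d). pose proof (Rmin_r delta d).
    assert (0 < Rmin delta d) by now apply Rmin_glb_lt.
    unfold s. lra. }
  exists s. split; [lra |].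
  assert (Hq : Rabs ((g (t + - s) - g t) / - s - l) < - l).
  { apply Hd; [lra | rewrite Rabs_Ropp, Rabs_pos_eq; lra]. }
  apply Rabs_def2 in Hq. destruct Hq as [Hq _].
  change (t - s) with (t + - s).
  assert (Hq' : (g t - g (t + - s)) / s < 0).
  { replace ((g t - g (t + - s)) / s) with ((g (t + - s) - g t) / - s) by (field; lra). lra. }
  destruct (Rle_lt_dec 0 (g (t + - s))) as [H | H]; [exact H |].
  assert (0 < (g t - g (t + - s)) / s); [| lra].
  apply Rdiv_lt_0_compat; lra.
Qed.

(* The Euler system in Riemann variables, with
   [lambda1 = beta * w + kappa * z] and [lambda2 = kappa * w + beta * z]. *)
Record riemann_system (kappa beta T : R) (w z wt wx zt zx : R -> R -> R) : Prop := {
  rs_w : C1_strip_with T w wt wx;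
  rs_z : C1_strip_with T z zt zx;
  rs_gap : forall t x, 0 <= t < T -> z t x < w t x;
  rs_eq_w : forall t x, 0 < t < T -> wt t x + (kappa * w t x + beta * z t x) * wx t x = 0;
  rs_eq_z : forall t x, 0 < t < T -> zt t x + (beta * w t x + kappa * z t x) * zx t x = 0
}.

(** * Maximum principle for the Riemann variables *)

Lemma abs_lin_comb_le (a b x y E : R) :
  Rabs x <= E -> Rabs y <= E -> Rabs (a * x + b * y) <= (Rabs a + Rabs b) * E.
Proof.
  intros Hx Hy.
  eapply Rle_trans; [apply Rabs_triang |]. rewrite !Rabs_mult.
  pose proof (Rmult_le_compat_l _ _ _ (Rabs_pos a) Hx).
  pose proof (Rmult_le_compat_l _ _ _ (Rabs_pos b) Hy). lra.
Qed.

(** Along the straight line of slope [v] the derivative of [f] vanishes at time [t], so the barrier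
    term alone contributes [- eps]. The line replaces the characteristic because only first-order
    behaviour at [t] matters; [f t x <> 0] makes the absolute value differentiable. *)
Lemma transported_abs_before (T : R) (f ft fx : R -> R -> R) (t x v E eps : R) :
  C1_strip_with T f ft fx -> 0 < t < T -> ft t x + v * fx t x = 0 ->
  0 < eps -> f t x <> 0 -> E + eps * t <= Rabs (f t x) ->
  forall delta, 0 < delta -> exists s, 0 < s < delta /\
    0 <= Rabs (f (t - s) (x - v * s)) - E - eps * (t - s).
Proof.
  intros Hf Ht Heq Heps Hn0 Hbig delta Hdelta.
  set (y := fun s => x + v * (s - t)).
  assert (Hyt : y t = x) by (unfold y; ring).
  assert (Hd : is_derive (fun s => Rabs (f s (y s)) - E - eps * s) t (- eps)).
  { assert (Hy : is_derive y t v) by (unfold y; auto_derive; [trivial | ring]).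
    pose proof (is_derive_along T f ft fx y t v Hf Ht Hy) as H1.
    rewrite Hyt, Heq in H1.
    apply is_derive_Rabs in H1; [| now rewrite Hyt].
    rewrite Rmult_0_r in H1.
    replace (- eps) with (0 - eps) by ring.
    apply (is_derive_minus (K := R_AbsRing) (V := R_NormedModule)
      (fun s => Rabs (f s (y s)) - E) (fun s => eps * s)).
    - replace 0 with (0 - 0) by ring.
      apply (is_derive_minus (K := R_AbsRing) (V := R_NormedModule)
        (fun s => Rabs (f s (y s))) (fun s => E)).
      + exact H1.
      + apply (is_derive_const (V := R_NormedModule) E t).
    - auto_derive; [trivial | ring]. }
  destruct (is_derive_neg_before _ t _ Hd ltac:(lra)) with (delta := delta) as [s [Hs H]];
    [cbv beta; rewrite Hyt; lra | exact Hdelta |].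
  exists s. split; [exact Hs |].
  replace (x - v * s) with (y (t - s)) by (unfold y; ring). exact H.
Qed.

(** Where the barrier [A + eps + eps * t] is touched, whichever of [w], [z] attains the maximum is
    transported with its own speed. Both are bounded by the barrier there, which bounds this speed
    and so supplies the cone slope without any prior bound on the solution. *)
Lemma riemann_max_principle (kappa beta T : R) (w z wt wx zt zx : R -> R -> R) (A : R) :
  riemann_system kappa beta T w z wt wx zt zx -> 0 <= A ->
  (forall x, Rabs (w 0 x) <= A) -> (forall x, Rabs (z 0 x) <= A) ->
  forall t x, 0 <= t < T -> Rabs (w t x) <= A /\ Rabs (z t x) <= A.
Proof.
  intros [Hw Hz _ Heqw Heqz] HA Hw0 Hz0 t1 x1 Ht1.
  assert (Hmax : forall eps, 0 < eps ->
    Rmax (Rabs (w t1 x1)) (Rabs (z t1 x1)) - (A + eps) - eps * t1 < 0).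
  { intros eps Heps.
    set (S := Rabs kappa + Rabs beta).
    assert (HS : 0 <= S) by (pose proof (Rabs_pos kappa); pose proof (Rabs_pos beta);
      unfold S; lra).
    assert (Het : 0 <= eps * t1) by (apply Rmult_le_pos; lra).
    apply (cone_barrier T
      (fun t x => Rmax (Rabs (w t x)) (Rabs (z t x)) - (A + eps) - eps * t)
      t1 x1 (S * (A + eps + eps * t1))); [| exact Ht1 | | |].
    - apply (cont_strip_minus T
        (fun t x => Rmax (Rabs (w t x)) (Rabs (z t x)) - (A + eps)) (fun t _ => eps * t)).
      + apply (cont_strip_minus T
          (fun t x => Rmax (Rabs (w t x)) (Rabs (z t x))) (fun _ _ => A + eps)).
        * apply (cont_strip_max T (fun t x => Rabs (w t x)) (fun t x => Rabs (z t x)));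
            apply cont_strip_comp; try (intros; apply continuous_Rabs);
            [apply Hw | apply Hz].
        * apply cont_strip_const.
      + apply (cont_strip_time T (fun t => eps * t)). intros t.
        apply (ex_derive_continuous (K := R_AbsRing) (V := R_NormedModule)).
        auto_derive. trivial.
    - apply Rmult_le_pos; lra.
    - intros x _. specialize (Hw0 x). specialize (Hz0 x).
      unfold Rmax; destruct Rle_dec; lra.
    - intros t x Ht _ HG.
      assert (Hee : eps * t <= eps * t1) by (apply Rmult_le_compat_l; lra).
      assert (Het0 : 0 <= eps * t) by (apply Rmult_le_pos; lra).
      pose proof (Rmax_l (Rabs (w t x)) (Rabs (z t x))) as Hml.
      pose proof (Rmax_r (Rabs (w t x)) (Rabs (z t x))) as Hmr.
      assert (Hspeed : forall a b, Rabs a + Rabs b = S ->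
        Rabs (a * w t x + b * z t x) <= S * (A + eps + eps * t1)).
      { intros a b <-. apply abs_lin_comb_le; lra. }
      (* The variable that reaches the barrier decides which of the two speeds is followed
         backward. *)
      destruct (Rmax_Rle (Rabs (w t x)) (Rabs (z t x)) (A + eps + eps * t)) as [Hor _].
      destruct Hor as [Hor | Hor]; [lra | |].
      + exists (kappa * w t x + beta * z t x).
        split; [now apply Hspeed |]. intros delta Hdelta.
        destruct (transported_abs_before T w wt wx t x (kappa * w t x + beta * z t x)
          (A + eps) eps Hw ltac:(lra)) with (delta := delta) as [s [Hs H]]; trivial.
        * apply Heqw; lra.
        * intros H0. rewrite H0, Rabs_R0 in Hor. lra.
        * exists s. split; [exact Hs |]. eapply Rle_trans; [exact H |].
          pose proof (Rmax_l (Rabs (w (t - s) (x - (kappa * w t x + beta * z t x) * s)))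
            (Rabs (z (t - s) (x - (kappa * w t x + beta * z t x) * s)))). lra.
      + exists (beta * w t x + kappa * z t x).
        split; [apply Hspeed; unfold S; ring |]. intros delta Hdelta.
        destruct (transported_abs_before T z zt zx t x (beta * w t x + kappa * z t x)
          (A + eps) eps Hz ltac:(lra)) with (delta := delta) as [s [Hs H]]; trivial.
        * apply Heqz; lra.
        * intros H0. rewrite H0, Rabs_R0 in Hor. lra.
        * exists s. split; [exact Hs |]. eapply Rle_trans; [exact H |].
          pose proof (Rmax_r (Rabs (w (t - s) (x - (beta * w t x + kappa * z t x) * s)))
            (Rabs (z (t - s) (x - (beta * w t x + kappa * z t x) * s)))). lra. }
  assert (Hlim : Rmax (Rabs (w t1 x1)) (Rabs (z t1 x1)) <= A).
  { apply le_epsilon. intros e He.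
    assert (H1 : 0 < e / (1 + t1)) by (apply Rdiv_lt_0_compat; lra).
    specialize (Hmax _ H1).
    assert (e / (1 + t1) + e / (1 + t1) * t1 = e) by (field; lra). lra. }
  split; eapply Rle_trans; try exact Hlim; [apply Rmax_l | apply Rmax_r].
Qed.

(** * One-sided gradient bound *)

Lemma difference_quotient_mean (f df : R -> R) (x eta : R) :
  (forall y, is_derive f y (df y)) -> 0 < eta ->
  exists xi, x <= xi <= x + eta /\ (f (x + eta) - f x) / eta = df xi.
Proof.
  intros Hf Heta.
  destruct (MVT_gen f x (x + eta) df) as [xi [Hxi E]].
  - intros y _. apply Hf.
  - intros y _. apply continuity_pt_filterlim.
    apply (ex_derive_continuous (K := R_AbsRing) (V := R_NormedModule)).
    eexists. apply Hf.
  - rewrite Rmin_left, Rmax_right in Hxi by lra.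
    exists xi. split; [exact Hxi |]. rewrite E. field. lra.
Qed.

(** Here [p], [q] and [r] will be [w], [z] and the shifted [w] along one straight line;
    [c + eps * s] is the barrier. *)
Lemma is_derive_weighted_quotient (theta eta c eps : R) (p q r : R -> R) (t p' q' r' : R) :
  is_derive p t p' -> is_derive q t q' -> is_derive r t r' -> q t < p t -> eta <> 0 ->
  is_derive (fun s => exp (theta * ln (p s - q s)) * ((r s - p s) / eta) - c - eps * s) t
    (exp (theta * ln (p t - q t)) *
       (theta * ((p' - q') / (p t - q t)) * ((r t - p t) / eta) + (r' - p') / eta) - eps).
Proof.
  intros Hp Hq Hr Hpq Heta.
  auto_derive.
  - repeat split; try (eexists; eassumption). lra.
  - replace (Derive (fun x => p x) t) with p' by (symmetry; now apply is_derive_unique).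
    replace (Derive (fun x => q x) t) with q' by (symmetry; now apply is_derive_unique).
    replace (Derive (fun x => r x) t) with r' by (symmetry; now apply is_derive_unique).
    unfold Rminus in *. field. lra.
Qed.

Lemma cont_strip_weight (T theta : R) (w z : R -> R -> R) :
  cont_strip T w -> cont_strip T z -> (forall t x, 0 <= t < T -> z t x < w t x) ->
  cont_strip T (fun t x => exp (theta * ln (w t x - z t x))).
Proof.
  intros Hw Hz Hgap.
  apply (cont_strip_comp T (fun d => exp (theta * ln d)) (fun t x => w t x - z t x)).
  - intros t x Ht. specialize (Hgap t x Ht).
    apply (ex_derive_continuous (K := R_AbsRing) (V := R_NormedModule)).
    auto_derive. lra.
  - now apply cont_strip_minus.
Qed.

(* Lax's Riccati argument for [e^h w_x], run on difference quotients because
   [w_x] itself need not be differentiable along characteristics: the weight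
   [e^h = (w - z)^theta] is the one for which the cross term [w_x z_x] cancels,
   leaving [(e^h w_x)' = - kappa e^h w_x^2 <= 0]. *)
Lemma weighted_gradient_bound (kappa beta theta T : R) (w z wt wx zt zx : R -> R -> R)
  (A B0 H0 : R) :
  riemann_system kappa beta T w z wt wx zt zx -> 0 <= kappa ->
  theta * (kappa - beta) = - beta -> 0 <= A ->
  (forall t x, 0 <= t < T -> Rabs (w t x) <= A /\ Rabs (z t x) <= A) ->
  (forall x, ex_derive (w 0) x) -> (forall x, Rabs (Derive (w 0) x) <= B0) ->
  (forall x, exp (theta * ln (w 0 x - z 0 x)) <= H0) ->
  forall t x, 0 < t < T -> exp (theta * ln (w t x - z t x)) * wx t x <= H0 * B0.
Proof.
  intros [Hw Hz Hgap Heqw Heqz] Hkappa Htheta HA Hbd Hex HB0 HH0 t1 x1 Ht1.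
  set (E := fun t x => exp (theta * ln (w t x - z t x))).
  assert (HEpos : forall t x, 0 < E t x) by (intros; apply exp_pos).
  assert (HE : cont_strip T E) by (apply cont_strip_weight; [apply Hw | apply Hz | exact Hgap]).
  set (M := (Rabs kappa + Rabs beta) * A).
  assert (HM : 0 <= M).
  { apply Rmult_le_pos; [| exact HA].
    pose proof (Rabs_pos kappa). pose proof (Rabs_pos beta). lra. }
  assert (HMt : 0 <= M * t1) by (apply Rmult_le_pos; lra).
  (* The interval contains the base of the cone, with room 1 on the right for the shift
     [eta <= 1]. *)
  set (a := x1 - M * t1). set (b := x1 + M * t1 + 1).
  destruct Hw as (Hwc & Hwtc & Hwxc & Hwd).
  destruct Hz as (Hzc & Hztc & Hzxc & Hzd).
  assert (Hslice : forall x t, 0 < t < T -> forall eta, 0 < eta ->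
    (exists xi, x <= xi <= x + eta /\ (w t (x + eta) - w t x) / eta = wx t xi) /\
    (exists xi, x <= xi <= x + eta /\ (z t (x + eta) - z t x) / eta = zx t xi)).
  { intros x t Ht eta Heta.
    split; apply difference_quotient_mean; trivial; intros y; [now apply Hwd | now apply Hzd]. }
  destruct (cont_strip_bounded T wx t1 a b Hwxc ltac:(lra)) as [Bw HBw].
  destruct (cont_strip_bounded T zx t1 a b Hzxc ltac:(lra)) as [Bz HBz].
  destruct (cont_strip_bounded T E t1 a b HE ltac:(lra)) as [Hb HHb].
  assert (HBwp := cond_pos Bw). assert (HBzp := cond_pos Bz). assert (HHbp := cond_pos Hb).
  assert (Hmain : forall eps, 0 < eps -> E t1 x1 * wx t1 x1 <= H0 * B0 + eps * (2 + t1)).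
  { intros eps Heps.
    (* [K * r] will bound the error from evaluating the gradients at different points of
       [[x, x + eta]], where [r] is their oscillation. The choice of [r] makes
       [Hb * K * r = eps / 2], which the barrier slope [eps] absorbs; the summand 1 gives [K >= 1],
       so that [Hb * r < eps] as well. *)
    set (K := Rabs beta * (Bw + Bz) + kappa * Bw + 1).
    assert (HK : 1 <= K).
    { assert (0 <= Rabs beta * (Bw + Bz)) by (apply Rmult_le_pos; [apply Rabs_pos | lra]).
      assert (0 <= kappa * Bw) by (apply Rmult_le_pos; lra). unfold K. lra. }
    assert (Hr : 0 < eps / (2 * Hb * K)).
    { apply Rdiv_lt_0_compat; [exact Heps |]. apply Rmult_lt_0_compat; lra. }
    set (r := mkposreal _ Hr).
    assert (HrK : Hb * (K * r) < eps).
    { unfold r; simpl. replace (Hb * (K * (eps / (2 * Hb * K)))) with (eps / 2) by (field; lra).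
      lra. }
    assert (Hr1 : Hb * r < eps).
    { apply Rle_lt_trans with (2 := HrK). apply Rmult_le_compat_l; [lra |].
      pose proof (cond_pos r). nra. }
    destruct (cont_strip_unif T wx t1 a b r Hwxc ltac:(lra)) as [dw Hdw].
    destruct (cont_strip_unif T zx t1 a b r Hzxc ltac:(lra)) as [dz Hdz].
    assert (Hosc : exists eta, 0 < eta <= 1 /\ forall t x x',
      0 <= t <= t1 -> a <= x <= b -> a <= x' <= b -> Rabs (x' - x) <= eta ->
      Rabs (wx t x' - wx t x) < r /\ Rabs (zx t x' - zx t x) < r).
    { assert (Hdwp := cond_pos dw). assert (Hdzp := cond_pos dz).
      exists (Rmin 1 (Rmin dw dz / 2)).
      assert (Hm : 0 < Rmin dw dz) by now apply Rmin_glb_lt.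
      pose proof (Rmin_l dw dz). pose proof (Rmin_r dw dz).
      pose proof (Rmin_r 1 (Rmin dw dz / 2)).
      split; [split; [apply Rmin_glb_lt; lra | apply Rmin_l] |].
      intros t x x' Ht Hx Hx' Hxx.
      split; [apply Hdw | apply Hdz]; trivial;
        try (rewrite Rminus_diag, Rabs_R0; assumption); lra. }
    destruct Hosc as [eta [Heta Hosc]].
    set (D := fun t x => (w t (x + eta) - w t x) / eta).
    assert (Hcone : forall t x, 0 <= t <= t1 -> Rabs (x - x1) <= M * (t1 - t) ->
      a <= x /\ x + eta <= b).
    { intros t x Ht Hx.
      assert (M * (t1 - t) <= M * t1) by (apply Rmult_le_compat_l; lra).
      apply Rabs_le_between in Hx. unfold a, b. lra. }
    assert (HG : E t1 x1 * D t1 x1 - (H0 * B0 + eps) - eps * t1 < 0).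
    { apply (cone_barrier T (fun t x => E t x * D t x - (H0 * B0 + eps) - eps * t) t1 x1 M);
        [| lra | exact HM | |].
      - apply (cont_strip_minus T (fun t x => E t x * D t x - (H0 * B0 + eps))
          (fun t _ => eps * t)).
        + apply (cont_strip_minus T (fun t x => E t x * D t x) (fun _ _ => H0 * B0 + eps));
            [| apply cont_strip_const].
          apply cont_strip_mult; [exact HE |].
          apply (cont_strip_mult T (fun t x => w t (x + eta) - w t x) (fun _ _ => / eta));
            [| apply cont_strip_const].
          apply (cont_strip_minus T (fun t x => w t (x + eta)) w); [| exact Hwc].
          now apply cont_strip_shift.
        + apply (cont_strip_time T (fun t => eps * t)). intros t.
          apply (ex_derive_continuous (K := R_AbsRing) (V := R_NormedModule)).
          auto_derive. trivial.
      - intros x _.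
        destruct (difference_quotient_mean (w 0) (Derive (w 0)) x eta) as [xi [_ Hxi]];
          [intros y; apply Derive_correct, Hex | lra |].
        specialize (HB0 xi). specialize (HH0 x).
        assert (HDB : Rabs (D 0 x) <= B0) by (unfold D; now rewrite Hxi).
        assert (Hle : E 0 x * D 0 x <= H0 * B0).
        { apply Rle_trans with (E 0 x * B0).
          - apply Rmult_le_compat_l; [left; apply HEpos |].
            apply Rle_trans with (2 := HDB), Rle_abs.
          - apply Rmult_le_compat_r; [| exact HH0].
            apply Rle_trans with (2 := HDB), Rabs_pos. }
        rewrite Rmult_0_r. lra.
      - intros t x Ht Hx HG0.
        destruct (Hcone t x ltac:(lra) Hx) as [Hxa Hxb].
        destruct (Hbd t x ltac:(lra)) as [HAw HAz].
        (* Both points [x] and [x + eta] are moved with the 2-speed taken at [x], so that they stay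
           at distance [eta]. *)
        set (v := kappa * w t x + beta * z t x).
        exists v. split; [now apply abs_lin_comb_le |].
        set (y := fun s => x + v * (s - t)).
        set (y2 := fun s => y s + eta).
        assert (Hyt : y t = x) by (unfold y; ring).
        assert (Hy2t : y2 t = x + eta) by (unfold y2; rewrite Hyt; ring).
        assert (Hdy : is_derive y t v) by (unfold y; auto_derive; [trivial | ring]).
        assert (Hdy2 : is_derive y2 t v) by (unfold y2, y; auto_derive; [trivial | ring]).
        assert (Ht' : 0 < t < T) by lra.
        pose proof (is_derive_along T w wt wx y t v
          (conj Hwc (conj Hwtc (conj Hwxc Hwd))) Ht' Hdy) as Hp.
        pose proof (is_derive_along T z zt zx y t v
          (conj Hzc (conj Hztc (conj Hzxc Hzd))) Ht' Hdy) as Hq.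
        pose proof (is_derive_along T w wt wx y2 t v
          (conj Hwc (conj Hwtc (conj Hwxc Hwd))) Ht' Hdy2) as Hrr.
        pose proof (is_derive_weighted_quotient theta eta (H0 * B0 + eps) eps
          (fun s => w s (y s)) (fun s => z s (y s)) (fun s => w s (y2 s)) t _ _ _ Hp Hq Hrr)
          as HdG.
        cbv beta in HdG. rewrite Hyt, Hy2t in HdG.
        specialize (HdG (Hgap t x ltac:(lra)) ltac:(lra)).
        intros delta Hdelta.
        edestruct (is_derive_neg_before _ t _ HdG) with (delta := delta) as [s [Hs H]].
        + destruct (Hslice x t Ht' eta ltac:(lra)) as [[xi [Hxi HDw]] [xj [Hxj HDz]]].
          pose proof (Hgap t x ltac:(lra)) as Hg.
          assert (Ew : wt t x + v * wx t x = 0) by (apply Heqw; exact Ht').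
          assert (Ez : zt t x + v * zx t x = (kappa - beta) * (w t x - z t x) * zx t x).
          { pose proof (Heqz t x Ht') as Ez. unfold v.
            replace (zt t x) with (- ((beta * w t x + kappa * z t x) * zx t x)) by lra. ring. }
          (* The shifted [w] is transported with its own speed, not with [v]. The difference of the
             speeds divided by [eta] is a mean value of the gradient of [lambda2], and this is the
             source of the quadratic term. *)
          assert (Er : (wt t (x + eta) + v * wx t (x + eta)) / eta
                       = - (kappa * wx t xi + beta * zx t xj) * wx t (x + eta)).
          { pose proof (Heqw t (x + eta) Ht') as Er. rewrite <- HDw, <- HDz. unfold v.
            replace (wt t (x + eta)) with
              (- ((kappa * w t (x + eta) + beta * z t (x + eta)) * wx t (x + eta))) by lra.
            field. lra. }
          rewrite Ew, Ez, HDw, Rminus_0_r, Er.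
          replace (theta * ((0 - (kappa - beta) * (w t x - z t x) * zx t x) / (w t x - z t x)))
            with (- (theta * (kappa - beta)) * zx t x) by (field; lra).
          rewrite Htheta.
          set (W1 := wx t xi). set (W2 := wx t (x + eta)).
          set (Z0 := zx t x). set (Z1 := zx t xj).
          assert (HW1 : Rabs W1 <= Bw) by (apply HBw; lra).
          assert (HZ1 : Rabs Z1 <= Bz) by (apply HBz; lra).
          assert (HZZ : Rabs (Z0 - Z1) < r).
          { apply Hosc; try lra. apply Rabs_le. lra. }
          assert (HWW : Rabs (W1 - W2) < r).
          { apply Hosc; try lra. apply Rabs_le. lra. }
          (* The cross terms [beta * Z0 * W1] and [beta * Z1 * W2] cancel up to oscillations, and
             [kappa * W1 * W2] is [kappa * W1 ^ 2] up to another one, leaving the Riccati term with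
             its favourable sign. *)
          replace (- - beta * Z0 * W1 + - (kappa * W1 + beta * Z1) * W2)
            with (beta * ((Z0 - Z1) * W1 + Z1 * (W1 - W2))
                  + kappa * (W1 * (W1 - W2)) - kappa * W1 ^ 2) by ring.
          assert (Hb1 : beta * ((Z0 - Z1) * W1 + Z1 * (W1 - W2)) <= Rabs beta * (Bw + Bz) * r).
          { eapply Rle_trans; [apply Rle_abs |]. rewrite Rabs_mult, Rmult_assoc.
            apply Rmult_le_compat_l; [apply Rabs_pos |].
            eapply Rle_trans; [apply Rabs_triang |]. rewrite !Rabs_mult.
            pose proof (Rabs_pos (Z0 - Z1)). pose proof (Rabs_pos W1).
            pose proof (Rabs_pos Z1). pose proof (Rabs_pos (W1 - W2)). nra. }
          assert (Hb2 : kappa * (W1 * (W1 - W2)) <= kappa * Bw * r).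
          { rewrite Rmult_assoc. apply Rmult_le_compat_l; [exact Hkappa |].
            eapply Rle_trans; [apply Rle_abs |]. rewrite Rabs_mult.
            pose proof (Rabs_pos W1). pose proof (Rabs_pos (W1 - W2)). nra. }
          assert (Hb3 : 0 <= kappa * W1 ^ 2)
            by (apply Rmult_le_pos; [exact Hkappa | apply pow2_ge_0]).
          fold (E t x).
          assert (HEb : E t x <= Hb).
          { apply Rle_trans with (1 := Rle_abs _). apply HHb; lra. }
          apply Rle_lt_trans with (Hb * (K * r) - eps); [| lra].
          apply Rplus_le_compat_r.
          apply Rle_trans with (E t x * (K * r)).
          * apply Rmult_le_compat_l; [left; apply HEpos |].
            pose proof (cond_pos r). unfold K. lra.
          * apply Rmult_le_compat_r; [| exact HEb].
            apply Rmult_le_pos; [lra | left; apply cond_pos].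
        + cbv beta. rewrite Hyt, Hy2t. right. symmetry. exact HG0.
        + exact Hdelta.
        + exists s. split; [exact Hs |].
          replace (x - v * s) with (y (t - s)) by (unfold y; ring). exact H. }
    assert (Hx1 : Rabs (x1 - x1) <= M * (t1 - t1)).
    { rewrite !Rminus_diag, Rabs_R0. lra. }
    destruct (Hcone t1 x1 ltac:(lra) Hx1) as [Hxa Hxb].
    destruct (Hslice x1 t1 Ht1 eta ltac:(lra)) as [[xi [Hxi HDw]] _].
    (* Replacing the difference quotient by [wx] at the apex costs one more [eps]; with
       [eps + eps * t1] from the barrier this gives [eps * (2 + t1)]. *)
    assert (HD : Rabs (wx t1 x1 - D t1 x1) < r).
    { unfold D. rewrite HDw. apply Hosc; try lra. apply Rabs_le. lra. }
    apply Rabs_def2 in HD.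
    assert (HEb : E t1 x1 <= Hb).
    { apply Rle_trans with (1 := Rle_abs _). apply HHb; lra. }
    assert (Hgapr : E t1 x1 * (wx t1 x1 - D t1 x1) <= Hb * r).
    { apply Rle_trans with (E t1 x1 * r).
      - apply Rmult_le_compat_l; [left; apply HEpos | lra].
      - apply Rmult_le_compat_r; [left; apply cond_pos | exact HEb]. }
    lra. }
  apply le_epsilon. intros e He. fold (E t1 x1).
  assert (H1 : 0 < e / (2 + t1)) by (apply Rdiv_lt_0_compat; lra).
  specialize (Hmain _ H1).
  replace (e / (2 + t1) * (2 + t1)) with e in Hmain by (field; lra). exact Hmain.
Qed.

(** * Growth of the weight along characteristics *)

Lemma is_derive_weight (theta : R) (p q : R -> R) (t p' q' : R) :
  is_derive p t p' -> is_derive q t q' -> q t < p t ->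
  is_derive (fun s => exp (theta * ln (p s - q s))) t
    (exp (theta * ln (p t - q t)) * (theta * ((p' - q') / (p t - q t)))).
Proof.
  intros Hp Hq Hpq.
  auto_derive.
  - repeat split; try (eexists; eassumption). lra.
  - replace (Derive (fun x => p x) t) with p' by (symmetry; now apply is_derive_unique).
    replace (Derive (fun x => q x) t) with q' by (symmetry; now apply is_derive_unique).
    unfold Rminus in *. field. lra.
Qed.

Lemma exp_mul_ln_le (theta x y : R) :
  0 <= theta -> 0 < x <= y -> exp (theta * ln x) <= exp (theta * ln y).
Proof.
  intros Htheta Hxy.
  assert (Hln : ln x <= ln y) by (apply ln_le; lra).
  destruct (Rmult_le_compat_l theta _ _ Htheta Hln) as [H | H].
  - left. now apply exp_increasing.
  - rewrite H. apply Rle_refl.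
Qed.

(* Along a 1-characteristic [(e^h)' = beta * e^h w_x], which is bounded above if
   [beta > 0]; otherwise [e^h] is a nondecreasing function of [w - z <= 2 A]. *)
Lemma weight_growth_along_1 (kappa beta theta T : R) (w z wt wx zt zx : R -> R -> R)
  (A B0 H0 y0 : R) (y : R -> R) :
  riemann_system kappa beta T w z wt wx zt zx -> 0 <= kappa -> beta < kappa ->
  theta * (kappa - beta) = - beta ->
  (forall x, Rabs (w 0 x) <= A) -> (forall x, Rabs (z 0 x) <= A) ->
  (forall x, ex_derive (w 0) x) -> (forall x, Rabs (Derive (w 0) x) <= B0) ->
  (forall x, exp (theta * ln (w 0 x - z 0 x)) <= H0) ->
  exp (theta * ln (2 * A)) <= H0 ->
  characteristic T (fun t x => beta * w t x + kappa * z t x) y0 y ->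
  forall t, 0 <= t < T ->
    exp (theta * ln (w t (y t) - z t (y t))) <= H0 + Rabs beta * (H0 * B0) * t.
Proof.
  intros Hsys Hkappa Hbk Htheta HAw HAz Hex HB0 HH0 HH1 [Hy0 [Hyr Hyd]] t Ht.
  assert (HA : 0 <= A) by (apply Rle_trans with (2 := HAw 0), Rabs_pos).
  assert (HBp : 0 <= B0) by (apply Rle_trans with (2 := HB0 0), Rabs_pos).
  assert (HHp : 0 < H0) by (apply Rlt_le_trans with (2 := HH1), exp_pos).
  assert (HC : 0 <= H0 * B0) by (apply Rmult_le_pos; lra).
  pose proof (riemann_max_principle _ _ _ _ _ _ _ _ _ A Hsys HA HAw HAz) as Hbd.
  destruct (Rle_lt_dec beta 0) as [Hbeta | Hbeta].
  { assert (Hth : 0 <= theta).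
    { apply Rmult_le_reg_r with (kappa - beta); lra. }
    assert (Hd : exp (theta * ln (w t (y t) - z t (y t))) <= exp (theta * ln (2 * A))).
    { apply exp_mul_ln_le; [exact Hth |].
      pose proof (rs_gap _ _ _ _ _ _ _ _ _ Hsys t (y t) Ht).
      destruct (Hbd t (y t) Ht) as [H1 H2].
      apply Rabs_le_between in H1. apply Rabs_le_between in H2. lra. }
    assert (0 <= Rabs beta * (H0 * B0) * t).
    { apply Rmult_le_pos; [apply Rmult_le_pos; [apply Rabs_pos | exact HC] | lra]. }
    lra. }
  rewrite (Rabs_pos_eq beta) by lra.
  set (E := fun s x => exp (theta * ln (w s x - z s x))).
  fold (E t (y t)).
  pose proof (weighted_gradient_bound _ _ _ _ _ _ _ _ _ _ A B0 H0 Hsys Hkappa Htheta HA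
    Hbd Hex HB0 HH0) as Hgrad.
  destruct Hsys as [Hw Hz Hgap Heqw Heqz].
  destruct (Rle_lt_or_eq_dec 0 t) as [Htp | <-]; [lra | |].
  2: { rewrite Rmult_0_r, Rplus_0_r. apply HH0. }
  (* [z] does not change along the curve, while [w] changes at the rate [(lambda1 - lambda2) * wx =
     - (kappa - beta) * (w - z) * wx]. The factor [w - z] cancels against the derivative of the
     logarithm, and [theta * (kappa - beta) = - beta] leaves [beta]. *)
  assert (Hder : forall s, 0 < s < T ->
    is_derive (fun s => E s (y s)) s (beta * (E s (y s) * wx s (y s)))).
  { intros s Hs.
    pose proof (is_derive_along T w wt wx y s _ Hw Hs (Hyd s Hs)) as Hp.
    pose proof (is_derive_along T z zt zx y s _ Hz Hs (Hyd s Hs)) as Hq.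
    cbv beta in Hp, Hq.
    pose proof (Hgap s (y s) ltac:(lra)) as Hg.
    pose proof (is_derive_weight theta (fun s => w s (y s)) (fun s => z s (y s)) s _ _ Hp Hq Hg)
      as Hd.
    cbv beta in Hd. rewrite (Heqz s (y s) Hs), Rminus_0_r in Hd.
    replace (beta * (E s (y s) * wx s (y s)))
      with (exp (theta * ln (w s (y s) - z s (y s))) *
        (theta * ((wt s (y s) + (beta * w s (y s) + kappa * z s (y s)) * wx s (y s)) /
           (w s (y s) - z s (y s))))); [exact Hd |].
    fold (E s (y s)). pose proof (Heqw s (y s) Hs) as He.
    replace (wt s (y s)) with (- ((kappa * w s (y s) + beta * z s (y s)) * wx s (y s))) by lra.
    replace beta with (- (theta * (kappa - beta))) at 3 by lra. field. lra. }
  assert (Hinc : forall s, 0 < s < t -> E t (y t) <= E s (y s) + beta * (H0 * B0) * t).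
  { intros s Hs.
    destruct (MVT_gen (fun s => E s (y s)) s t (fun s => beta * (E s (y s) * wx s (y s))))
      as [xi [Hxi Heq]]; rewrite Rmin_left, Rmax_right in * by lra.
    - intros r Hr. apply Hder. lra.
    - intros r Hr. apply continuity_pt_filterlim.
      apply (ex_derive_continuous (K := R_AbsRing) (V := R_NormedModule)
        (fun s => E s (y s))).
      eexists. apply Hder. lra.
    - pose proof (Hgrad xi (y xi) ltac:(lra)) as Hg. fold (E xi (y xi)) in Hg.
      assert (Hbc : 0 <= beta * (H0 * B0)) by (apply Rmult_le_pos; lra).
      assert (beta * (E xi (y xi) * wx xi (y xi)) * (t - s) <= beta * (H0 * B0) * t).
      { apply Rle_trans with (beta * (H0 * B0) * (t - s)).
        - apply Rmult_le_compat_r; [lra |]. apply Rmult_le_compat_l; lra.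
        - apply Rmult_le_compat_l; lra. }
      lra. }
  (* The equation of the curve is available for positive times only, so [Hinc] starts at [s > 0].
     Right continuity of [y] at 0 and continuity of [E] let [s] tend to 0. *)
  apply le_epsilon. intros e He.
  assert (HE : cont_strip T E) by (apply cont_strip_weight; [apply Hw | apply Hz | exact Hgap]).
  destruct (proj1 (cont_stripP T E) HE 0 y0 ltac:(lra) (mkposreal e He)) as [d Hd].
  destruct (Hyr (ball y0 d) (locally_ball _ d)) as [d' Hd'].
  assert (Hdp := cond_pos d). assert (Hdp' := cond_pos d').
  set (s := Rmin (Rmin d d') t / 2).
  assert (Hs : 0 < s < d /\ s < d' /\ s < t).
  { pose proof (Rmin_l (Rmin d d') t). pose proof (Rmin_r (Rmin d d') t).
    pose proof (Rmin_l d d'). pose proof (Rmin_r d d').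
    assert (0 < Rmin (Rmin d d') t) by (repeat apply Rmin_glb_lt; lra).
    unfold s. lra. }
  assert (Hys : Rabs (y s - y0) < d).
  { apply (Hd' s); [| lra]. change (Rabs (s - 0) < d'). apply Rabs_def1; lra. }
  assert (Hclose : Rabs (E s (y s) - E 0 y0) < e).
  { apply Hd; [lra | apply Rabs_def1; lra | exact Hys]. }
  apply Rabs_def2 in Hclose.
  pose proof (Hinc s ltac:(lra)). pose proof (HH0 y0) as HE0. fold (E 0 y0) in HE0. lra.
Qed.

(** * Reflection and the second characteristic family *)

Lemma C1_strip_with_reflect (T : R) (f ft fx : R -> R -> R) :
  C1_strip_with T f ft fx ->
  C1_strip_with T (fun t x => - f t (- x)) (fun t x => - ft t (- x)) (fun t x => fx t (- x)).
Proof.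
  assert (Hopp : forall g, cont_strip T g -> cont_strip T (fun t x => - g t (- x))).
  { intros g Hg.
    apply (cont_strip_comp T Ropp (fun t x => g t (- x))); [| now apply cont_strip_reflect].
    intros t x _. apply (continuous_opp (V := R_NormedModule)), continuous_id. }
  intros (Hf & Hft & Hfx & Hd).
  split; [now apply Hopp |]. split; [now apply Hopp |].
  split; [now apply cont_strip_reflect |].
  intros t x Ht. destruct (Hd t (- x) Ht) as [H1 H2]. split.
  - now apply (is_derive_opp (K := R_AbsRing) (V := R_NormedModule) (fun s => f s (- x))).
  - auto_derive; [eexists; exact H2 |].
    replace (Derive (fun y => f t y) (- x)) with (fx t (- x))
      by (symmetry; now apply is_derive_unique).
    ring.
Qed.

(* The symmetry [x -> -x], [u -> -u] exchanges the two characteristic families. *)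
Lemma riemann_system_reflect (kappa beta T : R) (w z wt wx zt zx : R -> R -> R) :
  riemann_system kappa beta T w z wt wx zt zx ->
  riemann_system kappa beta T (fun t x => - z t (- x)) (fun t x => - w t (- x))
    (fun t x => - zt t (- x)) (fun t x => zx t (- x))
    (fun t x => - wt t (- x)) (fun t x => wx t (- x)).
Proof.
  intros [Hw Hz Hgap Heqw Heqz]. constructor.
  - now apply C1_strip_with_reflect.
  - now apply C1_strip_with_reflect.
  - intros t x Ht. specialize (Hgap t (- x) Ht). lra.
  - intros t x Ht. specialize (Heqz t (- x) Ht). lra.
  - intros t x Ht. specialize (Heqw t (- x) Ht). lra.
Qed.

Lemma characteristic_reflect (T : R) (lam lam' : R -> R -> R) (y0 : R) (y : R -> R) :
  (forall t x, lam' t x = - lam t (- x)) ->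
  characteristic T lam y0 y -> characteristic T lam' (- y0) (fun t => - y t).
Proof.
  intros Hlam [Hy0 [Hyr Hyd]]. split; [now rewrite Hy0 |]. split.
  - apply (filterlim_comp _ _ _ y Ropp _ (locally y0)); [exact Hyr |].
    apply (filterlim_opp (K := R_AbsRing) (V := R_NormedModule)).
  - intros t Ht. rewrite Hlam, Ropp_involutive.
    apply (is_derive_opp (K := R_AbsRing) (V := R_NormedModule) y). now apply Hyd.
Qed.

(** The reflected curve [- y] is a 1-characteristic of the reflected system. The gap [w - z] is
    preserved, and the initial slope of the new [w] is that of [z] at the reflected point. *)
Lemma weight_growth_along_2 (kappa beta theta T : R) (w z wt wx zt zx : R -> R -> R)
  (A B0 H0 y0 : R) (y : R -> R) :
  riemann_system kappa beta T w z wt wx zt zx -> 0 <= kappa -> beta < kappa ->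
  theta * (kappa - beta) = - beta ->
  (forall x, Rabs (w 0 x) <= A) -> (forall x, Rabs (z 0 x) <= A) ->
  (forall x, ex_derive (z 0) x) -> (forall x, Rabs (Derive (z 0) x) <= B0) ->
  (forall x, exp (theta * ln (w 0 x - z 0 x)) <= H0) ->
  exp (theta * ln (2 * A)) <= H0 ->
  characteristic T (fun t x => kappa * w t x + beta * z t x) y0 y ->
  forall t, 0 <= t < T ->
    exp (theta * ln (w t (y t) - z t (y t))) <= H0 + Rabs beta * (H0 * B0) * t.
Proof.
  intros Hsys Hkappa Hbk Htheta HAw HAz Hex HB0 HH0 HH1 Hy t Ht.
  assert (Hgap : forall t x, - z t (- x) - - w t (- x) = w t (- x) - z t (- x))
    by (intros; ring).
  assert (Hz0 : forall x, is_derive (fun x => - z 0 (- x)) x (Derive (z 0) (- x))).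
  { intros x. auto_derive; [apply Hex |].
    change (Derive (fun y => z 0 y) (- x)) with (Derive (z 0) (- x)). ring. }
  pose proof (weight_growth_along_1 kappa beta theta T _ _ _ _ _ _ A B0 H0 (- y0)
    (fun s => - y s) (riemann_system_reflect _ _ _ _ _ _ _ _ _ Hsys) Hkappa Hbk Htheta) as H.
  cbv beta in H. rewrite <- (Ropp_involutive (y t)).
  rewrite <- Hgap. apply H; trivial.
  - intros x. rewrite Rabs_Ropp. apply HAz.
  - intros x. rewrite Rabs_Ropp. apply HAw.
  - intros x. eexists. apply Hz0.
  - intros x. rewrite (is_derive_unique (fun x' : R => - z 0 (- x')) _ _ (Hz0 x)). apply HB0.
  - intros x. rewrite Hgap. apply HH0.
  - refine (characteristic_reflect T _ _ y0 y _ Hy). intros s x. ring.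
Qed.

(** * The Euler system in Riemann variables *)

(* The closed form of [riemann_integral] for the power law. *)
Definition sound_potential (k gamma r : R) : R :=
  2 * k * sqrt gamma / (gamma - 1) * Rpower r ((gamma - 1) / 2).

Lemma is_derive_pressure (k gamma r : R) :
  0 < r -> is_derive (pressure k gamma) r (k ^ 2 * (gamma * Rpower r (gamma - 1))).
Proof.
  intros Hr.
  apply (is_derive_scal (fun r => Rpower r gamma)).
  apply is_derive_Reals. now apply derivable_pt_lim_power.
Qed.

(** Both sides equal [k * sqrt gamma * r^((gamma - 1) / 2)]. Since [w - z] is twice the potential,
    this makes the eigenvalues linear in the Riemann variables. *)
Lemma sound_speed_potential (k gamma r : R) :
  0 < k -> 1 < gamma -> 0 < r ->
  sound_speed k gamma r = (gamma - 1) / 2 * sound_potential k gamma r.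
Proof.
  intros Hk Hgamma Hr.
  unfold sound_speed. rewrite (is_derive_unique _ _ _ (is_derive_pressure k gamma r Hr)).
  replace ((gamma - 1) / 2 * sound_potential k gamma r)
    with (k * sqrt gamma * Rpower r ((gamma - 1) / 2))
    by (unfold sound_potential; field; lra).
  assert (Hs : 0 < sqrt gamma) by (apply sqrt_lt_R0; lra).
  apply sqrt_lem_1.
  - apply Rmult_le_pos; [apply pow2_ge_0 |].
    apply Rmult_le_pos; [lra | left; apply exp_pos].
  - apply Rmult_le_pos; [apply Rmult_le_pos; lra | left; apply exp_pos].
  - assert (Hpow : Rpower r (gamma - 1)
      = Rpower r ((gamma - 1) / 2) * Rpower r ((gamma - 1) / 2)).
    { rewrite <- Rpower_plus. f_equal. field. }
    rewrite Hpow.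
    transitivity (k ^ 2 * (sqrt gamma * sqrt gamma *
      (Rpower r ((gamma - 1) / 2) * Rpower r ((gamma - 1) / 2)))); [ring |].
    now rewrite sqrt_sqrt by lra.
Qed.

Lemma is_derive_sound_potential (k gamma r : R) :
  0 < k -> 1 < gamma -> 0 < r ->
  is_derive (sound_potential k gamma) r (sound_speed k gamma r / r).
Proof.
  intros Hk Hgamma Hr.
  rewrite (sound_speed_potential k gamma r Hk Hgamma Hr).
  replace ((gamma - 1) / 2 * sound_potential k gamma r / r)
    with (2 * k * sqrt gamma / (gamma - 1) *
          ((gamma - 1) / 2 * Rpower r ((gamma - 1) / 2 - 1))).
  - apply (is_derive_scal (fun r => Rpower r ((gamma - 1) / 2))).
    apply is_derive_Reals. now apply derivable_pt_lim_power.
  - assert (Hpow : Rpower r ((gamma - 1) / 2 - 1) = Rpower r ((gamma - 1) / 2) / r).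
    { unfold Rminus at 1. rewrite Rpower_plus, Rpower_Ropp, Rpower_1 by lra. reflexivity. }
    unfold sound_potential. rewrite Hpow. field. lra.
Qed.

Lemma sound_potential_pos (k gamma r : R) :
  0 < k -> 1 < gamma -> 0 < sound_potential k gamma r.
Proof.
  intros Hk Hgamma. unfold sound_potential.
  apply Rmult_lt_0_compat; [| apply exp_pos].
  apply Rdiv_lt_0_compat; [| lra].
  apply Rmult_lt_0_compat; [lra | apply sqrt_lt_R0; lra].
Qed.

(** The exponent [(gamma - 1) / 2] is positive. The limit 0 shows that this antiderivative has the
    right constant for the integral from 0. *)
Lemma sound_potential_vanishes (k gamma : R) :
  1 < gamma -> filterlim (sound_potential k gamma) (at_right 0) (locally 0).
Proof.
  intros Hgamma.
  unfold sound_potential.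
  rewrite <- (Rmult_0_r (2 * k * sqrt gamma / (gamma - 1))) at 2.
  apply (filterlim_comp _ _ _ (fun r => Rpower r ((gamma - 1) / 2))
    (fun y => 2 * k * sqrt gamma / (gamma - 1) * y) _ (locally 0));
    [| apply (filterlim_scal_r (V := R_NormedModule))].
  unfold Rpower.
  apply (filterlim_comp _ _ _ (fun r => (gamma - 1) / 2 * ln r) exp _
    (Rbar_locally m_infty)); [| exact is_lim_exp_m].
  apply (filterlim_comp _ _ _ ln (fun y => (gamma - 1) / 2 * y) _
    (Rbar_locally m_infty)); [exact is_lim_ln_0 |].
  pose proof (filterlim_Rbar_mult_l ((gamma - 1) / 2) m_infty) as H.
  replace (Rbar_mult ((gamma - 1) / 2) m_infty) with m_infty in H; [exact H |].
  symmetry. apply is_Rbar_mult_unique, is_Rbar_mult_sym, is_Rbar_mult_m_infty_pos.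
  simpl. lra.
Qed.

(** On [[a, r]] with [a > 0] the fundamental theorem gives a difference of potentials; then [a]
    tends to 0 from the right. *)
Lemma riemann_integral_potential (k gamma r : R) :
  0 < k -> 1 < gamma -> 0 < r -> riemann_integral k gamma r = sound_potential k gamma r.
Proof.
  intros Hk Hgamma Hr.
  apply (is_RInt_gen_unique (V := R_CompleteNormedModule)
    (Fa := at_right 0) (Fb := at_point r)).
  intros P HP.
  assert (Hint : forall a, 0 < a -> is_RInt (fun s => sound_speed k gamma s / s) a r
    (sound_potential k gamma r - sound_potential k gamma a)).
  { intros a Ha.
    assert (Hpos : forall x, Rmin a r <= x -> 0 < x).
    { intros x Hx. apply Rlt_le_trans with (2 := Hx). now apply Rmin_glb_lt. }
    apply (is_RInt_derive (V := R_CompleteNormedModule) (sound_potential k gamma)).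
    - intros x Hx. apply is_derive_sound_potential; trivial. apply Hpos, Hx.
    - intros x Hx.
      assert (Hx0 : 0 < x) by apply Hpos, Hx.
      apply (continuous_ext_loc _
        (fun s => (gamma - 1) / 2 * sound_potential k gamma s / s)).
      + exists (mkposreal x Hx0). intros s Hs. change (Rabs (s - x) < x) in Hs.
        apply Rabs_def2 in Hs.
        rewrite sound_speed_potential; trivial. lra.
      + apply (ex_derive_continuous (K := R_AbsRing) (V := R_NormedModule)).
        auto_derive. split; [| lra].
        eexists. now apply is_derive_sound_potential. }
  assert (Hlim : filterlim (fun a => sound_potential k gamma r - sound_potential k gamma a)
    (at_right 0) (locally (sound_potential k gamma r))).
  { replace (locally (sound_potential k gamma r))
      with (locally (sound_potential k gamma r + - 0)) by (f_equal; ring).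
    apply (filterlim_comp_2 (fun _ => sound_potential k gamma r)
      (fun a => - sound_potential k gamma a) Rplus (G := locally (sound_potential k gamma r))
      (H := locally (- 0))).
    - apply filterlim_const.
    - apply (filterlim_comp _ _ _ (sound_potential k gamma) Ropp _ (locally 0)).
      + now apply sound_potential_vanishes.
      + apply (filterlim_opp (K := R_AbsRing) (V := R_NormedModule)).
    - apply (filterlim_plus (K := R_AbsRing) (V := R_NormedModule)). }
  apply (Filter_prod _ _ _
    (fun a => 0 < a /\ P (sound_potential k gamma r - sound_potential k gamma a))
    (fun b => b = r)).
  - apply filter_and; [| exact (Hlim P HP)].
    exists (mkposreal 1 Rlt_0_1). now intros a _ Ha.
  - reflexivity.
  - intros a b [Ha HPa] ->. eexists. split; [| exact HPa]. now apply Hint.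
Qed.

(** Once the velocity equation is isolated, adding or subtracting [p'] times the mass equation
    diagonalizes the system, with speeds [u + c] and [u - c], where [c] is the sound speed. *)
Lemma euler_riemann_system (k gamma : R) (rho0 u0 : R -> R) (T : R) (rho u : R -> R -> R) :
  0 < k -> 1 < gamma -> C1_Euler_solution k gamma rho0 u0 T rho u ->
  exists wt wx zt zx,
    riemann_system ((gamma + 1) / 4) ((3 - gamma) / 4) T
      (fun t x => u t x + sound_potential k gamma (rho t x))
      (fun t x => u t x - sound_potential k gamma (rho t x)) wt wx zt zx.
Proof.
  intros Hk Hgamma
    [HT Hpos (Hrho & rt & rx & Hrt & Hrx & Hrd) (Hu & ut & ux & Hut & Hux & Hud)
     Hmass Hmom _ _].
  set (p := sound_potential k gamma).
  (* This is [sound_speed / r] in closed form, which can be differentiated again to obtain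
     continuity of the extended derivatives. *)
  set (p' := fun r => (gamma - 1) / 2 * p r / r).
  assert (Hp : forall r, 0 < r -> is_derive p r (p' r)).
  { intros r Hr. unfold p', p. rewrite <- sound_speed_potential by trivial.
    now apply is_derive_sound_potential. }
  assert (Hcp : cont_strip T (fun t x => p (rho t x))).
  { apply cont_strip_comp; [| exact Hrho]. intros t x Ht.
    apply (ex_derive_continuous (K := R_AbsRing) (V := R_NormedModule)).
    eexists. apply Hp, Hpos, Ht. }
  assert (Hcp' : cont_strip T (fun t x => p' (rho t x))).
  { apply cont_strip_comp; [| exact Hrho]. intros t x Ht.
    specialize (Hpos t x Ht).
    apply (ex_derive_continuous (K := R_AbsRing) (V := R_NormedModule)).
    unfold p'. auto_derive. split; [| lra]. eexists. now apply Hp. }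
  assert (Hpd : forall t x, 0 < t < T ->
    is_derive (fun s => p (rho s x)) t (p' (rho t x) * rt t x) /\
    is_derive (fun y => p (rho t y)) x (p' (rho t x) * rx t x)).
  { intros t x Ht. destruct (Hrd t x Ht) as [H1 H2].
    rewrite (Rmult_comm _ (rt t x)), (Rmult_comm _ (rx t x)).
    split; apply (is_derive_comp p); trivial; apply Hp, Hpos; lra. }
  assert (Heq : forall t x, 0 < t < T ->
    rt t x + rx t x * u t x + rho t x * ux t x = 0 /\
    ut t x + u t x * ux t x + p' (rho t x) ^ 2 * rho t x * rx t x = 0).
  { intros t x Ht.
    assert (Hr := Hpos t x ltac:(lra)).
    destruct (Hrd t x Ht) as [Dr1 Dr2]. destruct (Hud t x Ht) as [Du1 Du2].
    assert (Er1 : Derive (fun s : R => rho s x) t = rt t x) by now apply is_derive_unique.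
    assert (Er2 : Derive (fun y : R => rho t y) x = rx t x) by now apply is_derive_unique.
    assert (Eu1 : Derive (fun s : R => u s x) t = ut t x) by now apply is_derive_unique.
    assert (Eu2 : Derive (fun y : R => u t y) x = ux t x) by now apply is_derive_unique.
    assert (Dm : is_derive (fun y => rho t y * u t y) x
      (rx t x * u t x + rho t x * ux t x)).
    { auto_derive; [repeat split; eexists; eassumption |].
      rewrite Er2, Eu2. ring. }
    assert (Dm1 : is_derive (fun s => rho s x * u s x) t
      (rt t x * u t x + rho t x * ut t x)).
    { auto_derive; [repeat split; eexists; eassumption |].
      rewrite Er1, Eu1. ring. }
    assert (Dm2 : is_derive (fun y => rho t y * u t y ^ 2) x
      (rx t x * u t x ^ 2 + rho t x * (2 * u t x * ux t x))).
    { auto_derive; [repeat split; eexists; eassumption |].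
      rewrite Er2, Eu2. ring. }
    assert (Dp : is_derive (fun y => pressure k gamma (rho t y)) x
      (rx t x * (k ^ 2 * (gamma * Rpower (rho t x) (gamma - 1))))).
    { apply (is_derive_comp (pressure k gamma)); [now apply is_derive_pressure | exact Dr2]. }
    assert (Hc2 : k ^ 2 * (gamma * Rpower (rho t x) (gamma - 1)) = (p' (rho t x) * rho t x) ^ 2).
    { unfold p', p. rewrite <- sound_speed_potential by trivial. unfold sound_speed.
      rewrite (is_derive_unique _ _ _ (is_derive_pressure k gamma (rho t x) Hr)).
      replace (sqrt (k ^ 2 * (gamma * Rpower (rho t x) (gamma - 1))) / rho t x * rho t x)
        with (sqrt (k ^ 2 * (gamma * Rpower (rho t x) (gamma - 1)))) by (field; lra).
      symmetry. apply pow2_sqrt.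
      apply Rmult_le_pos; [apply pow2_ge_0 |].
      apply Rmult_le_pos; [lra | left; apply exp_pos]. }
    assert (M1 : rt t x + (rx t x * u t x + rho t x * ux t x) = 0).
    { rewrite <- (Hmass t x Ht).
      rewrite Er1, (is_derive_unique (fun y : R => rho t y * u t y) _ _ Dm). reflexivity. }
    assert (M2 := Hmom t x Ht).
    rewrite (is_derive_unique (fun s : R => rho s x * u s x) _ _ Dm1) in M2.
    rewrite (is_derive_unique (fun y : R => rho t y * u t y ^ 2) _ _ Dm2) in M2.
    rewrite (is_derive_unique (fun y : R => pressure k gamma (rho t y)) _ _ Dp) in M2.
    rewrite Hc2 in M2.
    split; [lra |].
    (* The momentum equation minus [u] times the mass equation is [rho] times the velocity equation,
       and [rho] is positive. *)
    apply Rmult_eq_reg_l with (rho t x); [| lra].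
    rewrite Rmult_0_r.
    rewrite <- M2.
    replace (rt t x) with (- (rx t x * u t x + rho t x * ux t x)) by lra. ring. }
  exists (fun t x => ut t x + p' (rho t x) * rt t x), (fun t x => ux t x + p' (rho t x) * rx t x),
    (fun t x => ut t x - p' (rho t x) * rt t x), (fun t x => ux t x - p' (rho t x) * rx t x).
  assert (Hc : forall t x, 0 <= t < T -> (gamma - 1) / 2 * p (rho t x) = p' (rho t x) * rho t x).
  { intros t x Ht. specialize (Hpos t x Ht). unfold p'. field. lra. }
  constructor.
  - split; [now apply (cont_strip_plus T u (fun t x => p (rho t x))) |].
    split; [now apply (cont_strip_plus T ut), (cont_strip_mult T (fun t x => p' (rho t x))) |].
    split; [now apply (cont_strip_plus T ux), (cont_strip_mult T (fun t x => p' (rho t x))) |].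
    intros t x Ht. destruct (Hud t x Ht), (Hpd t x Ht).
    split; now apply (is_derive_plus (K := R_AbsRing) (V := R_NormedModule)).
  - split; [now apply (cont_strip_minus T u (fun t x => p (rho t x))) |].
    split; [now apply (cont_strip_minus T ut), (cont_strip_mult T (fun t x => p' (rho t x))) |].
    split; [now apply (cont_strip_minus T ux), (cont_strip_mult T (fun t x => p' (rho t x))) |].
    intros t x Ht. destruct (Hud t x Ht), (Hpd t x Ht).
    split; now apply (is_derive_minus (K := R_AbsRing) (V := R_NormedModule)).
  - intros t x _. pose proof (sound_potential_pos k gamma (rho t x) Hk Hgamma). unfold p. lra.
  - intros t x Ht. destruct (Heq t x Ht) as [M1 M2].
    replace ((gamma + 1) / 4 * (u t x + p (rho t x)) + (3 - gamma) / 4 * (u t x - p (rho t x)))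
      with (u t x + (gamma - 1) / 2 * p (rho t x)) by field.
    rewrite Hc by lra.
    replace (rt t x) with (- (rx t x * u t x + rho t x * ux t x)) by lra.
    replace (ut t x) with (- (u t x * ux t x + p' (rho t x) ^ 2 * rho t x * rx t x)) by lra.
    ring.
  - intros t x Ht. destruct (Heq t x Ht) as [M1 M2].
    replace ((3 - gamma) / 4 * (u t x + p (rho t x)) + (gamma + 1) / 4 * (u t x - p (rho t x)))
      with (u t x - (gamma - 1) / 2 * p (rho t x)) by field.
    rewrite Hc by lra.
    replace (rt t x) with (- (rx t x * u t x + rho t x * ux t x)) by lra.
    replace (ut t x) with (- (u t x * ux t x + p' (rho t x) ^ 2 * rho t x * rx t x)) by lra.
    ring.
Qed.

(** * Real bounds extracted from the initial data *)

Lemma sup_norm_spec (f : R -> R) :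
  sup_norm f = p_infty \/
  exists B, 0 <= B /\ sup_norm f = Finite B /\ forall x, Rabs (f x) <= B.
Proof.
  assert (Hub : forall x, Rbar_le (Rabs (f x)) (sup_norm f)).
  { intros x. destruct (Lub_Rbar_correct (fun r => exists x, r = Rabs (f x))) as [H _].
    apply (H (Rabs (f x))). now exists x. }
  destruct (sup_norm f) as [B | |]; [right | now left | now specialize (Hub 0)].
  exists B. split; [| now split].
  apply Rle_trans with (2 := Hub 0), Rabs_pos.
Qed.

Lemma C1_norm_pair_bounded (f g : R -> R) :
  Rbar_lt (C1_norm_pair f g) p_infty ->
  exists B, 0 < B /\ forall x, Rabs (f x) <= B /\ Rabs (g x) <= B /\
    Rabs (Derive f x) <= B /\ Rabs (Derive g x) <= B.
Proof.
  unfold C1_norm_pair, C1_norm. intros Hlt.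
  destruct (sup_norm_spec f) as [E1 | (a & Ha & E1 & H1)],
    (sup_norm_spec (Derive f)) as [E2 | (b & Hb & E2 & H2)],
    (sup_norm_spec g) as [E3 | (c & Hc & E3 & H3)],
    (sup_norm_spec (Derive g)) as [E4 | (d & Hd & E4 & H4)];
    rewrite E1, E2, E3, E4 in Hlt; try easy.
  exists (a + b + c + d + 1). split; [lra |]. intros x.
  specialize (H1 x). specialize (H2 x). specialize (H3 x). specialize (H4 x).
  repeat split; lra.
Qed.

Lemma inf_R_pos (f : R -> R) : Rbar_lt 0 (inf_R f) -> exists m, 0 < m /\ forall x, m <= f x.
Proof.
  unfold inf_R. intros Hlt.
  destruct (Glb_Rbar_correct (fun r => exists x, r = f x)) as [H _].
  destruct (Glb_Rbar (fun r => exists x, r = f x)) as [m | |]; [| | easy].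
  - exists m. split; [exact Hlt |]. intros x. apply (H (f x)). now exists x.
  - exfalso. apply (H (f 0)). now exists 0.
Qed.

(** A power is monotone, in a direction given by the sign of [theta]; the sum of the endpoint values
    dominates it in both cases. *)
Lemma exp_mul_ln_le_ends (theta m d M : R) :
  0 < m -> m <= d <= M -> exp (theta * ln d) <= exp (theta * ln m) + exp (theta * ln M).
Proof.
  intros Hm Hd.
  pose proof (exp_pos (theta * ln m)). pose proof (exp_pos (theta * ln M)).
  destruct (Rle_lt_dec 0 theta) as [H1 | H1].
  - pose proof (exp_mul_ln_le theta d M H1 ltac:(lra)). lra.
  - pose proof (exp_mul_ln_le (- theta) m d ltac:(lra) ltac:(lra)) as H2.
    rewrite !Ropp_mult_distr_l_reverse, !exp_Ropp in H2.
    apply Rinv_le_contravar in H2; [| apply Rinv_0_lt_compat, exp_pos].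
    rewrite !Rinv_inv in H2. lra.
Qed.

Lemma characteristic_ext (T : R) (lam lam' : R -> R -> R) (y0 : R) (y : R -> R) :
  (forall t x, 0 < t < T -> lam t x = lam' t x) ->
  characteristic T lam y0 y -> characteristic T lam' y0 y.
Proof.
  intros Hlam [Hy0 [Hyr Hyd]]. split; [exact Hy0 |]. split; [exact Hyr |].
  intros t Ht. rewrite <- Hlam by exact Ht. now apply Hyd.
Qed.

(** * Derivatives of the eigenvalues and the final estimate *)

Lemma lambda1_z_eq (gamma w z : R) : lambda1_z gamma w z = (gamma + 1) / 4.
Proof.
  apply is_derive_unique. unfold lambda1_wz. auto_derive; [trivial | field].
Qed.

Lemma lambda2_w_eq (gamma w z : R) : lambda2_w gamma w z = (gamma + 1) / 4.
Proof.
  apply is_derive_unique. unfold lambda2_wz. auto_derive; [trivial | field].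
Qed.

(** Linear growth of [exp h] is inverted. The summand 1 in the slope keeps it positive when [C = 0],
    which occurs for [gamma = 3]. *)
Lemma inv_weight_ge (h kappa H0 C t : R) :
  0 < kappa -> 0 < H0 -> 0 <= C -> 0 <= t -> exp h <= H0 + C * t ->
  exp (- h) * kappa >= 1 / (H0 / kappa + (C / kappa + 1) * t).
Proof.
  intros Hk HH HC Ht Hle.
  pose proof (exp_pos h) as He.
  rewrite exp_Ropp.
  assert (Hq : exp h / kappa <= H0 / kappa + (C / kappa + 1) * t).
  { apply Rle_trans with ((H0 + C * t) / kappa).
    - apply Rmult_le_compat_r; [left; now apply Rinv_0_lt_compat | exact Hle].
    - replace (H0 / kappa + (C / kappa + 1) * t) with ((H0 + C * t) / kappa + t)
        by (field; lra). lra. }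
  apply Rle_ge.
  replace (/ exp h * kappa) with (/ (exp h / kappa)) by (field; lra).
  unfold Rdiv at 1. rewrite Rmult_1_l.
  apply Rinv_le_contravar; [now apply Rdiv_lt_0_compat | exact Hq].
Qed.

Theorem lemma4p2 (k gamma : R) (hk : 0 < k) (hgamma : 1 < gamma)
  (rho0 u0 : R -> R) :
  let w0 := fun x => riemann_w k gamma (rho0 x) (u0 x) in
  let z0 := fun x => riemann_z k gamma (rho0 x) (u0 x) in
  Rbar_lt 0 (inf_R (fun x => w0 x - z0 x)) ->
  C1_R w0 -> C1_R z0 ->
  Rbar_lt (C1_norm_pair w0 z0) p_infty ->
  exists C1 C2 : R, 0 < C1 /\ 0 < C2 /\
    forall (T : R) (rho u : R -> R -> R),
      C1_Euler_solution k gamma rho0 u0 T rho u ->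
      let w := fun t x => riemann_w k gamma (rho t x) (u t x) in
      let z := fun t x => riemann_z k gamma (rho t x) (u t x) in
      (forall (y0 : R) (y : R -> R),
         characteristic T (fun t x => lambda1 k gamma (rho t x) (u t x)) y0 y ->
         forall t, 0 <= t < T ->
           exp (- h_tilde gamma (w t (y t)) (z t (y t)))
             * lambda1_z gamma (w t (y t)) (z t (y t))
           >= 1 / (C1 + C2 * t)) /\
      (forall (y0 : R) (y : R -> R),
         characteristic T (fun t x => lambda2 k gamma (rho t x) (u t x)) y0 y ->
         forall t, 0 <= t < T ->
           exp (- h_tilde gamma (w t (y t)) (z t (y t)))
             * lambda2_w gamma (w t (y t)) (z t (y t))
           >= 1 / (C1 + C2 * t)).
Proof.
  intros w0 z0 Hinf Hw0 Hz0 Hnorm.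
  destruct (inf_R_pos _ Hinf) as [m [Hm Hgap0]].
  destruct (C1_norm_pair_bounded _ _ Hnorm) as [B [HB Hbd]].
  set (theta := (gamma - 3) / (2 * gamma - 2)).
  set (kappa := (gamma + 1) / 4). set (beta := (3 - gamma) / 4).
  (* The initial gap lies in [[m, 2 * B]], so [H0] bounds the initial weight for either sign of
     [theta]; it also bounds the weight at [2 * B], used when [beta <= 0]. *)
  set (H0 := exp (theta * ln m) + exp (theta * ln (2 * B))).
  assert (Hkappa : 0 < kappa) by (unfold kappa; lra).
  assert (Hbk : beta < kappa) by (unfold kappa, beta; lra).
  assert (Htheta : theta * (kappa - beta) = - beta)
    by (unfold theta, kappa, beta; field; lra).
  assert (HH0 : 0 < H0) by (apply Rplus_lt_0_compat; apply exp_pos).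
  assert (HH1 : exp (theta * ln (2 * B)) <= H0)
    by (pose proof (exp_pos (theta * ln m)); unfold H0; lra).
  assert (HC : 0 <= Rabs beta * (H0 * B)).
  { apply Rmult_le_pos; [apply Rabs_pos | apply Rmult_le_pos; lra]. }
  (* The constants are built from [gamma], [m] and [B] before [T] and the solution are introduced,
     hence they are independent of the time. *)
  exists (H0 / kappa), (Rabs beta * (H0 * B) / kappa + 1).
  split; [now apply Rdiv_lt_0_compat |]. split.
  { assert (0 <= Rabs beta * (H0 * B) / kappa); [| lra].
    apply Rmult_le_pos; [exact HC | left; now apply Rinv_0_lt_compat]. }
  intros T rho u Hsol.
  destruct (euler_riemann_system k gamma rho0 u0 T rho u hk hgamma Hsol)
    as (wt & wx & zt & zx & Hsys).
  fold kappa beta in Hsys.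
  set (w' := fun t x => u t x + sound_potential k gamma (rho t x)) in Hsys.
  set (z' := fun t x => u t x - sound_potential k gamma (rho t x)) in Hsys.
  assert (Hpos := sol_rho_pos _ _ _ _ _ _ _ Hsol).
  assert (HT := sol_time _ _ _ _ _ _ _ Hsol).
  assert (Ew : forall t x, 0 <= t < T -> riemann_w k gamma (rho t x) (u t x) = w' t x).
  { intros t x Ht. unfold riemann_w. rewrite riemann_integral_potential; auto. }
  assert (Ez : forall t x, 0 <= t < T -> riemann_z k gamma (rho t x) (u t x) = z' t x).
  { intros t x Ht. unfold riemann_z. rewrite riemann_integral_potential; auto. }
  assert (Ew0 : forall x, w0 x = w' 0 x).
  { intros x. rewrite <- Ew by lra. unfold w0.
    now rewrite <- (sol_rho_init _ _ _ _ _ _ _ Hsol), <- (sol_u_init _ _ _ _ _ _ _ Hsol). }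
  assert (Ez0 : forall x, z0 x = z' 0 x).
  { intros x. rewrite <- Ez by lra. unfold z0.
    now rewrite <- (sol_rho_init _ _ _ _ _ _ _ Hsol), <- (sol_u_init _ _ _ _ _ _ _ Hsol). }
  assert (El : forall t x, 0 < t < T ->
    lambda1 k gamma (rho t x) (u t x) = beta * w' t x + kappa * z' t x /\
    lambda2 k gamma (rho t x) (u t x) = kappa * w' t x + beta * z' t x).
  { intros t x Ht. unfold lambda1, lambda2.
    rewrite sound_speed_potential by (trivial; apply Hpos; lra).
    unfold w', z', kappa, beta. split; field. }
  assert (Hw'0 : forall x, Rabs (w' 0 x) <= B) by (intros x; rewrite <- Ew0; apply Hbd).
  assert (Hz'0 : forall x, Rabs (z' 0 x) <= B) by (intros x; rewrite <- Ez0; apply Hbd).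
  assert (HE0 : forall x, exp (theta * ln (w' 0 x - z' 0 x)) <= H0).
  { intros x. apply exp_mul_ln_le_ends; [exact Hm |].
    specialize (Hgap0 x). specialize (Hw'0 x). specialize (Hz'0 x).
    apply Rabs_le_between in Hw'0. apply Rabs_le_between in Hz'0.
    rewrite Ew0, Ez0 in Hgap0. lra. }
  split; intros y0 y Hy t Ht; cbv beta zeta; rewrite Ew, Ez by exact Ht.
  - rewrite lambda1_z_eq. fold kappa.
    apply inv_weight_ge; try lra. unfold h_tilde. fold theta.
    apply (weight_growth_along_1 kappa beta theta T w' z' wt wx zt zx B B H0 y0 y);
      trivial; [lra | | |].
    + intros x. apply (ex_derive_ext w0); [exact Ew0 | apply Hw0].
    + intros x. rewrite <- (Derive_ext w0) by exact Ew0. apply Hbd.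
    + refine (characteristic_ext T _ _ y0 y _ Hy). intros s x Hs. now apply El.
  - rewrite lambda2_w_eq. fold kappa.
    apply inv_weight_ge; try lra. unfold h_tilde. fold theta.
    apply (weight_growth_along_2 kappa beta theta T w' z' wt wx zt zx B B H0 y0 y);
      trivial; [lra | | |].
    + intros x. apply (ex_derive_ext z0); [exact Ez0 | apply Hz0].
    + intros x. rewrite <- (Derive_ext z0) by exact Ez0. apply Hbd.
    + refine (characteristic_ext T _ _ y0 y _ Hy). intros s x Hs. now apply El.
Qed.
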